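(* Let $G=SL(n,\mathbb C)$, let $T\subseteq B\subseteq G$ be a maximal torus and a Borel subgroup, let $\alpha_0=\omega_1+\omega_{n-1}$ be the highest root and $P=P_1\cap P_{n-1}\supseteq B$ the corresponding parabolic subgroup. Let $w\in W^P$ be such that $X_P(w)^{ss}_T(\mathcal L_{\alpha_0})$ is nonempty. Then the GIT quotient $X_P(w)^{ss}_T(\mathcal L_{\alpha_0})/\!/T$ is isomorphic to a projective space.
   Context: $P_r$ denotes the maximal parabolic subgroup containing $B$ associated to the simple root $\alpha_r$, and $\omega_i$ are the fundamental weights. $W=S_n$ is the Weyl group and $W^P$ the set of minimal length representatives of $W/W_P$; $X_P(w)=\overline{BwP/P}\subset G/P$ is the Schubert variety. $\mathcal L_{\alpha_0}$ is the (very ample) homogeneous line bundle on $G/P$ associated to $\alpha_0$, with $H^0(G/P,\mathcal L_{\alpha_0})\cong V(\alpha_0)^*$, with its natural $G$-linearization, restricted to $X_P(w)$. $X_P(w)^{ss}_T(\mathcal L_{\alpha_0})$ is the set of $x\in X_P(w)$ such that some $T$-invariant section of some power $\mathcal L_{\alpha_0}^m$, $m\geq 1$, on $X_P(w)$ does not vanish at $x$. The GIT quotient is $\mathrm{Proj}\big(\bigoplus_{m\ge 0}H^0(X_P(w),\mathcal L_{m\alpha_0})^T\big)$. A projective space $\mathbb P^d$ may have any dimension $d\geq 0$. *)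

(* Defs.v *)
From HB Require Import structures.
From mathcomp Require Import all_boot all_order all_fingroup all_algebra.
From mathcomp Require Import boolp classical_sets functions.
From mathcomp Require Import reals complex mpoly.

Set Implicit Arguments.
Unset Strict Implicit.
Unset Printing Implicit Defensive.

Import Order.TTheory GRing.Theory Num.Theory.
Local Open Scope ring_scope.
Local Open Scope classical_set_scope.

(* Commutative N-graded F-algebras.  [A] encodes the *external* direct sum of  *)
(* its pieces: an element of degree m is a member of [ga_piece A m], and the   *)
(* ambient ring [ga_ring A] only supplies the operations.                      *)
Record gradedAlg (F : fieldType) := GradedAlg {
  ga_ring :> comPzRingType;
  ga_cst : {rmorphism F -> ga_ring};
  ga_piece : nat -> set ga_ring;
  ga_piece0 : forall m, ga_piece m 0;
  ga_pieceB : forall m a b, ga_piece m a -> ga_piece m b -> ga_piece m (a - b);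
  ga_pieceC : forall c, ga_piece 0%N (ga_cst c);
  ga_pieceM : forall k m a b,
    ga_piece k a -> ga_piece m b -> ga_piece (k + m)%N (a * b)
}.

Section Proj.
Variables (F : fieldType) (A : gradedAlg F).
Local Notation piece := (@ga_piece F A).

(* A homogeneous ideal is given by its family of homogeneous components; for   *)
(* such an ideal, primality only has to be tested on homogeneous elements.     *)
Record homog_prime (p : nat -> set A) : Prop := HomogPrime {
  hp_sub : forall m, p m `<=` piece m;
  hp_0 : forall m, p m 0;
  hp_D : forall m a b, p m a -> p m b -> p m (a + b);
  hp_M : forall k m a b, piece k a -> p m b -> p (k + m)%N (a * b);
  hp_1 : ~ p 0%N 1;
  hp_prime : forall k m a b, piece k a -> piece m b ->
    p (k + m)%N (a * b) -> p k a \/ p m b;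
  hp_relevant : exists m a, [/\ (0 < m)%N, piece m a & ~ p m a]
}.

Record Proj := MkProj { pt_ideal :> nat -> set A; _ : homog_prime pt_ideal }.

(* Complements of the closed sets V(E), E a set of homogeneous elements.       *)
Definition Proj_open (U : set Proj) : Prop :=
  exists E : nat -> set A, (forall m, E m `<=` piece m) /\
    U = [set p : Proj | exists m a, E m a /\ ~ p m a].

(* The local ring A_(p) of degree-0 fractions num/den, with num and den of     *)
(* the same degree and den outside p; its elements are equivalence classes.    *)
Record hfrac := HFrac { hdeg : nat; hnum : A; hden : A }.

Definition hfrac_at (p : Proj) (x : hfrac) : Prop :=
  [/\ piece (hdeg x) (hnum x), piece (hdeg x) (hden x) & ~ p (hdeg x) (hden x)].

Definition hfrac_equiv (p : Proj) (x y : hfrac) : Prop :=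
  exists k u, [/\ piece k u, ~ p k u
                & u * (hnum x * hden y - hnum y * hden x) = 0].

Definition hfrac_class (p : Proj) (x : hfrac) : set hfrac :=
  [set y | hfrac_at p y /\ hfrac_equiv p x y].

Definition hfrac_add (x y : hfrac) : hfrac :=
  HFrac (hdeg x + hdeg y)%N (hnum x * hden y + hnum y * hden x)
        (hden x * hden y).

Definition hfrac_mul (x y : hfrac) : hfrac :=
  HFrac (hdeg x + hdeg y)%N (hnum x * hnum y) (hden x * hden y).

Definition hfrac_cst (c : F) : hfrac := HFrac 0%N (ga_cst A c) 1.

(* The structure sheaf: a section over U sends p in U to an element of A_(p),  *)
(* locally a single fraction.  By convention it takes the value set0 (which is *)
(* not a class) outside U, so that sections over U are equal as functions      *)
(* exactly when they agree on U.                                               *)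
Definition germs := Proj -> set hfrac.

Definition Proj_sections (U : set Proj) : set germs :=
  [set s | (forall p, ~ U p -> s p = set0) /\
    forall p, U p -> exists V : set Proj, [/\ Proj_open V, V p, V `<=` U &
      exists x : hfrac, forall q, V q ->
        hfrac_at q x /\ s q = hfrac_class q x]].

Definition germs_add (s t : germs) : germs := fun p =>
  [set z | exists x y, [/\ s p x, t p y & hfrac_class p (hfrac_add x y) z]].

Definition germs_mul (s t : germs) : germs := fun p =>
  [set z | exists x y, [/\ s p x, t p y & hfrac_class p (hfrac_mul x y) z]].

Definition germs_cst (U : set Proj) (c : F) : germs := fun p =>
  [set z | U p /\ hfrac_class p (hfrac_cst c) z].

Definition germs_res (V : set Proj) (s : germs) : germs := fun p =>
  [set z | V p /\ s p z].

End Proj.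

(* Isomorphism of Proj A and Proj B as ringed spaces over F: a homeomorphism   *)
(* phi with F-algebra isomorphisms O_B(V) -> O_A(phi^-1 V) compatible with     *)
(* restrictions.  Locality on stalks is automatic for an isomorphism.          *)
Definition Proj_iso (F : fieldType) (A B : gradedAlg F) : Prop :=
  exists (phi : Proj A -> Proj B)
         (phis : set (Proj B) -> germs B -> germs A),
  [/\ bijective phi,
      forall V, Proj_open V <-> Proj_open (phi @^-1` V) &
      forall V, Proj_open V ->
      [/\ set_bij (Proj_sections V) (Proj_sections (phi @^-1` V)) (phis V),
          forall s t, Proj_sections V s -> Proj_sections V t ->
            phis V (germs_add s t) = germs_add (phis V s) (phis V t),
          forall s t, Proj_sections V s -> Proj_sections V t ->
            phis V (germs_mul s t) = germs_mul (phis V s) (phis V t),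
          forall c, phis V (germs_cst V c) = germs_cst (phi @^-1` V) c &
          forall W s, Proj_open W -> W `<=` V -> Proj_sections V s ->
            phis W (germs_res W s) = germs_res (phi @^-1` W) (phis V s)]].

(* The homogeneous coordinate ring F[x_0, ..., x_d] of P^d.                    *)
Section ProjectiveSpace.
Variables (F : fieldType) (d : nat).

Let piece (m : nat) : set {mpoly F[d.+1]} := [set p | p \is m.-homog].

Let piece0 m : piece m 0. Proof. exact: dhomog0. Qed.
Let pieceB m a b : piece m a -> piece m b -> piece m (a - b).
Proof. exact: rpredB. Qed.
Let pieceC c : piece 0%N c%:MP_[d.+1]. Proof. by rewrite /piece /= -alg_mpolyC dhomogZ ?dhomog1. Qed.
Let pieceM k m a b : piece k a -> piece m b -> piece (k + m)%N (a * b).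
Proof. exact: dhomogM. Qed.

Definition polyAlg : gradedAlg F :=
  @GradedAlg F {mpoly F[d.+1]} (@mpolyC d.+1 F : {rmorphism F -> _}) piece
    piece0 pieceB pieceC pieceM.

End ProjectiveSpace.

Section WeylGroup.
Variable n : nat.

(* The simple reflections s_r = (r, r+1), 1 <= r <= n-1, with r in D; the      *)
(* indices 1, ..., n of the mathematics are the ordinals 0, ..., n-1.          *)
Definition simple_refls (D : pred nat) : {set 'S_n} :=
  [set tperm ij.1 ij.2 | ij : 'I_n * 'I_n &
     (nat_of_ord ij.2 == ij.1.+1) && D ij.1.+1]%SET.

(* W_P for P = P_1 \cap P_{n-1}.                                               *)
Definition weyl_P : {set 'S_n} :=
  <<simple_refls [pred r | (r != 1%N) && (r != n.-1)]>>%g.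

(* w \in W^P: w has minimal length in w W_P.  Here [u \in S ^+ k] says that u  *)
(* is a product of k simple reflections, and [(v * w)%g] is the composite      *)
(* w \o v.                                                                     *)
Definition min_coset_rep (w : 'S_n) : Prop :=
  forall v k, v \in weyl_P -> (v * w \in simple_refls predT ^+ k)%g ->
  exists2 l, (l <= k)%N & (w \in simple_refls predT ^+ l)%g.

End WeylGroup.

Section Group.
(* The columns of the invertible matrix h form a basis of F^n; T is the torus  *)
(* of SL_n diagonal in this basis and B the Borel subgroup upper triangular in *)
(* it.  As all pairs T <= B are conjugate, every such pair arises this way.    *)
Variables (F : closedFieldType) (n : nat) (h : 'M[F]_n).

Definition in_basis (g : 'M[F]_n) : 'M[F]_n := invmx h *m g *m h.

Definition SL : set 'M[F]_n := [set g | \det g = 1].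

Definition torus : set 'M[F]_n := [set g | SL g /\ is_diag_mx (in_basis g)].

Definition borel : set 'M[F]_n :=
  [set g | SL g /\ forall i j : 'I_n, (j < i)%N -> in_basis g i j = 0].

(* P_r: the stabilizer of the span of the first r basis vectors.               *)
Definition parabolic (r : nat) : set 'M[F]_n :=
  [set g | SL g /\ forall i j : 'I_n, (j < r <= i)%N -> in_basis g i j = 0].

Definition parab : set 'M[F]_n := parabolic 1 `&` parabolic n.-1.

(* omega_r as a character of P_r: the determinant of the upper left r x r      *)
(* block (padded here by an identity block), equal to t_1 ... t_r on T.        *)
Definition fund_weight (r : nat) (p : 'M[F]_n) : F :=
  \det (\matrix_(i < n, j < n)
          if (i < r)%N && (j < r)%N then in_basis p i j else (i == j)%:R).

Definition alpha0 (p : 'M[F]_n) : F := fund_weight 1 p * fund_weight n.-1 p.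

(* The representatives of w in the normalizer of T in SL_n.                    *)
Definition weyl_rep (w : 'S_n) : set 'M[F]_n :=
  [set g | SL g /\ forall i j : 'I_n, in_basis g i j != 0 -> i = w j].

(* A polynomial in the n^2 matrix entries, evaluated at g.                     *)
Definition eval_mx (q : {mpoly F[n * n]}) (g : 'M[F]_n) : F :=
  q.@[fun k => mxvec g 0 k].

Definition zariski_closed (Z : set 'M[F]_n) : Prop :=
  exists I : set {mpoly F[n * n]},
    Z = [set g | SL g /\ forall q, I q -> eval_mx q g = 0].

(* Points of G/P, P = P_1 \cap P_{n-1}, are cosets gP; its closed sets are     *)
(* those whose preimage in G is Zariski closed.                                *)
Definition gcoset (g : 'M[F]_n) : set 'M[F]_n := [set g *m p | p in parab].

Definition flag_closed (Z : set (set 'M[F]_n)) : Prop :=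
  zariski_closed [set g | SL g /\ Z (gcoset g)].

Definition bruhat_cell (w : 'S_n) : set (set 'M[F]_n) :=
  [set x | exists b u, [/\ borel b, weyl_rep w u & x = gcoset (b *m u)]].

Definition schubert (w : 'S_n) : set (set 'M[F]_n) :=
  [set x | (exists2 g, SL g & x = gcoset g) /\
    forall Z, flag_closed Z -> bruhat_cell w `<=` Z -> Z x].

Variable w : 'S_n.

(* The preimage of X_P(w) in G.                                                *)
Definition schubert_preim : Type :=
  {g : 'M[F]_n | SL g /\ schubert w (gcoset g)}.

(* H^0(X_P(w), L_{m alpha0}).  L_chi is the bundle G x^P F associated to chi,  *)
(* so that its sections over X_P(w) are the regular functions on the preimage  *)
(* of X_P(w) with f(gp) = chi(p) f(g); the preimage being closed in the affine *)
(* variety SL_n, regular functions on it are restrictions of polynomials.      *)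
(* With this sign, H^0(G/P, L_{alpha0}) is V(alpha0)^* for the left            *)
(* translation action of G.                                                    *)
Definition line_sections (m : nat) : set (schubert_preim -> F) :=
  [set f | (exists q, forall g, f g = eval_mx q (sval g)) /\
    forall g g' p, parab p -> sval g' = sval g *m p ->
      f g' = alpha0 p ^+ m * f g].

Definition inv_sections (m : nat) : set (schubert_preim -> F) :=
  [set f | line_sections m f /\
    forall g g' t, torus t -> sval g' = t *m sval g -> f g' = f g].

Definition semistable : set (set 'M[F]_n) :=
  [set x | schubert w x /\ exists m f (g : schubert_preim),
    [/\ (0 < m)%N, inv_sections m f, gcoset (sval g) = x & f g != 0]].

Definition cst_fun (c : F) : schubert_preim -> F := fun=> c.

Let cst_funB : {morph cst_fun : x y / x - y}. Proof. by []. Qed.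
Let cst_funM : monoid_morphism cst_fun. Proof. by []. Qed.

HB.instance Definition _ :=
  GRing.isZmodMorphism.Build F (schubert_preim -> F) cst_fun cst_funB.
HB.instance Definition _ :=
  GRing.isMonoidMorphism.Build F (schubert_preim -> F) cst_fun cst_funM.

Let inv0 m : inv_sections m 0.
Proof.
split; last by [].
split; first by exists 0 => g; rewrite /eval_mx meval0.
by move=> g g' p _ _ /=; rewrite mulr0.
Qed.

Let invB m a b : inv_sections m a -> inv_sections m b -> inv_sections m (a - b).
Proof.
move=> [[[q aq] aP] aT] [[[r br] bP] bT].
have E g : (a - b) g = a g - b g by [].
split; [split|].
- by exists (q - r) => g; rewrite E aq br /eval_mx mevalB.
- by move=> g g' p Pp e; rewrite !E (aP _ _ _ Pp e) (bP _ _ _ Pp e) mulrBr.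
- by move=> g g' t Tt e; rewrite !E (aT _ _ _ Tt e) (bT _ _ _ Tt e).
Qed.

Let invC c : inv_sections 0%N (cst_fun c).
Proof.
split; last by [].
split; first by exists c%:MP => g; rewrite /eval_mx mevalC.
by move=> g g' p _ _ /=; rewrite expr0 mul1r.
Qed.

Let invM k m a b :
  inv_sections k a -> inv_sections m b -> inv_sections (k + m)%N (a * b).
Proof.
move=> [[[q aq] aP] aT] [[[r br] bP] bT].
have E g : (a * b) g = a g * b g by [].
split; [split|].
- by exists (q * r) => g; rewrite E aq br /eval_mx mevalM.
- move=> g g' p Pp e; rewrite !E (aP _ _ _ Pp e) (bP _ _ _ Pp e).
  by rewrite exprD mulrACA.
- by move=> g g' t Tt e; rewrite !E (aT _ _ _ Tt e) (bT _ _ _ Tt e).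
Qed.

(* The graded algebra of T-invariant sections of the powers of L_{alpha0}; the *)
(* GIT quotient is its Proj.                                                   *)
Definition invAlg : gradedAlg F :=
  @GradedAlg F (schubert_preim -> F)
    (cst_fun : {rmorphism F -> (schubert_preim -> F)}) inv_sections
    inv0 invB invC invM.

End Group.

(* Main.v *)
Require Import Defs.
From HB Require Import structures.
From mathcomp Require Import all_boot all_order all_fingroup all_algebra.
From mathcomp Require Import boolp classical_sets functions.
From mathcomp Require Import reals complex mpoly.
From mathcomp Require Import zify ring.

Set Implicit Arguments.
Unset Strict Implicit.
Unset Printing Implicit Defensive.

Import Order.TTheory GRing.Theory Num.Theory.
Local Open Scope ring_scope.
Local Open Scope classical_set_scope.

(* Put i = w(1) and j = w(n), and attach to the coset of g in G/P the flag     *)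
(* (x, xi), x the first column of g and xi the last row of its inverse; then   *)
(* xi x = 0.  The Bruhat cell of w is the set of flags with x supported on     *)
(* [1, i], xi supported on [j, n] and x_i, xi_j nonzero.  If i < j, a torus    *)
(* element acting by 2 after k = i shows that invariants of positive degree    *)
(* vanish.  If j < i, the invariants of degree m are the degree m forms in     *)
(* y_k = x_k xi_k, j <= k < i (incidence gives y_i = - sum of the others), so  *)
(* the quotient is Proj of a polynomial ring in i - j variables.               *)
(* That every invariant f is such a form is seen on explicit slices: using T   *)
(* and P, a generic flag of the cell is moved to x = (1, ..., 1, 0, ..., 0),   *)
(* where f becomes y_j^m p(y / y_j) with p a polynomial.  Its degree is at     *)
(* most m because s^m p(z / s) is again polynomial in s, as seen in a chart    *)
(* where another coordinate of xi is normalised.  One-parameter deformations   *)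
(* in B extend the identity from generic flags to the cell, and the definition *)
(* of the Schubert variety as a closure extends it from the cell.              *)

(** * Graded isomorphisms induce isomorphisms of Proj *)

(** A point gP is a flag whose x and xi are each determined up to a scalar. [alpha0E] identifies
    [alpha0] with the factor by which P multiplies every product y_k = x_k xi_k, and T fixes these
    products, so degree m forms in the y_k are invariant sections of degree m. The theorem amounts
    to two facts when j < i: on X_P(w) there are no other invariants, and the y_k with j <= k < i
    satisfy no relation. The invariant ring is then a polynomial ring, degree by degree, and
    [graded_iso_Proj_iso] compares the two Proj.

    [same_flag] and [bruhat_cellP] translate cosets and cells into supports of (x, xi), and
    [inv_section_equivariant] turns invariance into the rescaling rule [cell_equivariant]. For i <
    j, [cell_equivariant_lt] finds a rescaling that fixes the flag but multiplies the value by 2^m,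
    so semistability forces j < i ([semistable_lt]).

    For j < i, a generic flag of the cell is moved onto the slice [base_mx], whose parameters are
    the ratios y_k / y_j. [base_poly_degree] bounds the degree of an invariant there,
    [homogenize_meval] makes it a form in y, [eval_mx_cell] extends the formula to the cell and
    [schubert_eq0] to its closure. Independence is [dhomog_ymon_eq0]: the slice realises every y
    with y_j = 1. *)

Section GradedIso.
Variables (F : fieldType) (A B : gradedAlg F) (f : {rmorphism B -> A}).
Hypothesis f_cst : forall c, f (ga_cst B c) = ga_cst A c.
Hypothesis f_bij : forall m, set_bij (@ga_piece F B m) (@ga_piece F A m) f.

Local Notation pieceA := (@ga_piece F A).
Local Notation pieceB := (@ga_piece F B).

Lemma graded_iso_piece m b : pieceB m b -> pieceA m (f b).
Proof. by case: (f_bij m) => fun_f _ _; apply: fun_f. Qed.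

Lemma graded_iso_inj m b c : pieceB m b -> pieceB m c -> f b = f c -> b = c.
Proof. by case: (f_bij m) => _ inj_f _ Pb Pc; apply: inj_f; rewrite inE. Qed.

Lemma graded_iso_surj m a : pieceA m a -> exists2 b, pieceB m b & f b = a.
Proof. by case: (f_bij m) => _ _ surj_f /surj_f [b]; exists b. Qed.

Lemma ga_pieceN (C : gradedAlg F) m a : ga_piece (g := C) m a -> ga_piece m (- a).
Proof. by move=> Pa; rewrite -sub0r; apply: ga_pieceB => //; apply: ga_piece0. Qed.

Lemma ga_pieceD (C : gradedAlg F) m a b :
  ga_piece (g := C) m a -> ga_piece m b -> ga_piece m (a + b).
Proof. by move=> Pa Pb; rewrite -[b]opprK; apply: ga_pieceB => //; apply: ga_pieceN. Qed.

Lemma ga_piece1 (C : gradedAlg F) : ga_piece (g := C) 0 1.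
Proof. by rewrite -(rmorph1 (ga_cst C)); apply: ga_pieceC. Qed.

(** Membership in the piece is demanded separately: [f] could also send elements outside [pieceB m]
    into [p m]. *)
Definition pull_ideal (p : nat -> set A) : nat -> set B :=
  fun m => [set b | pieceB m b /\ p m (f b)].

Definition push_ideal (p : nat -> set B) : nat -> set A :=
  fun m => [set a | exists2 b, p m b & f b = a].

Lemma pull_homog_prime p : homog_prime p -> homog_prime (pull_ideal p).
Proof.
case=> ps p0 pD pM p1 pp pr; split.
- by move=> m b [].
- by move=> m; split; [apply: ga_piece0 | rewrite rmorph0].
- move=> m a b [Pa pa] [Pb pb]; split; first exact: ga_pieceD.
  by rewrite rmorphD; apply: pD.
- move=> k m a b Pa [Pb pb]; split; first exact: ga_pieceM.
  by rewrite rmorphM; apply: pM => //; apply: graded_iso_piece.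
- by case=> _; rewrite rmorph1.
- move=> k m a b Pa Pb [_]; rewrite rmorphM => pab.
  case: (pp k m _ _ _ _ pab); try exact: graded_iso_piece.
  + by left.
  + by right.
- case: pr => m [a [m0 Pa npa]]; case: (graded_iso_surj Pa) => b Pb e.
  by exists m, b; split=> // -[_]; rewrite e.
Qed.

Lemma push_idealE p m b : homog_prime p -> pieceB m b ->
  push_ideal p m (f b) <-> p m b.
Proof.
move=> hp Pb; split; last by exists b.
by by case=> c pc /(graded_iso_inj (hp_sub hp pc) Pb) <-.
Qed.

Lemma push_homog_prime p : homog_prime p -> homog_prime (push_ideal p).
Proof.
move=> hp; case: (hp) => ps p0 pD pM p1 pp pr; split.
- by move=> m _ [b pb <-]; apply/graded_iso_piece/ps.
- by move=> m; exists 0 => //; rewrite rmorph0.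
- by move=> m _ _ [a pa <-] [b pb <-]; exists (a + b); [apply: pD | rewrite rmorphD].
- move=> k m _ _ /graded_iso_surj [a Pa <-] [b pb <-].
  by exists (a * b); [apply: pM | rewrite rmorphM].
- by rewrite -(rmorph1 f) push_idealE //; apply: ga_piece1.
- move=> k m _ _ /graded_iso_surj [a Pa <-] /graded_iso_surj [b Pb <-].
  rewrite -rmorphM !push_idealE //; first exact: pp.
  exact: ga_pieceM.
- case: pr => m [a [m0 Pa npa]]; exists m, (f a); split=> //.
    exact: graded_iso_piece.
  by rewrite push_idealE.
Qed.

Lemma Proj_prime (C : gradedAlg F) (p : Proj C) : homog_prime p.
Proof. by case: p. Qed.

Lemma Proj_eq (C : gradedAlg F) (p q : Proj C) :
  (forall m a, p m a <-> q m a) -> p = q.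
Proof.
case: p q => [p hp] [q hq] /= pq.
have e : p = q by apply/funext => m; apply/seteqP; split=> a /pq.
by case: _ / e hq => hq; rewrite (Prop_irrelevance hp hq).
Qed.

Definition Proj_pull (p : Proj A) : Proj B :=
  MkProj (pull_homog_prime (Proj_prime p)).

Definition Proj_push (p : Proj B) : Proj A :=
  MkProj (push_homog_prime (Proj_prime p)).

Lemma Proj_pullE (p : Proj A) m b :
  pieceB m b -> Proj_pull p m b <-> p m (f b).
Proof. by move=> Pb; split=> [[]|]. Qed.

Lemma Proj_pullK : cancel Proj_pull Proj_push.
Proof.
move=> p; apply: Proj_eq => m a; split=> [[b [_ pb] <-] //|pa].
case: (graded_iso_surj (hp_sub (Proj_prime p) pa)) => b Pb e.
by exists b; rewrite ?e //; split; rewrite ?e.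
Qed.

Lemma Proj_pushK : cancel Proj_push Proj_pull.
Proof.
move=> p; apply: Proj_eq => m b; split=> [[Pb]|pb].
  by move/(push_idealE (Proj_prime p) Pb).
by split; [apply: (hp_sub (Proj_prime p)) | exists b].
Qed.

Lemma Proj_pull_open V : Proj_open V <-> Proj_open (Proj_pull @^-1` V).
Proof.
split=> [[E [EP ->]]|[E [EP e]]].
  exists (fun m => [set f b | b in E m]); split.
    by move=> m _ [b Eb <-]; apply/graded_iso_piece/EP.
  apply/seteqP; split=> p /=.
    move=> [m [b [Eb npb]]]; exists m, (f b); split; first by exists b.
    by move/Proj_pullE: npb; apply; apply: EP.
  move=> [m [_ [[b Eb <-] npb]]]; exists m, b; split=> //.
  by case=> _.
exists (fun m => [set b | pieceB m b /\ E m (f b)]); split; first by move=> m b [].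
have {}e p : V (Proj_pull p) <-> exists m a, E m a /\ ~ p m a.
  by move/seteqP: e => [e1 e2]; split; [apply: e1 | apply: e2].
apply/seteqP; split=> p /=.
  rewrite -{1}(Proj_pushK p) => /e [m [a [Ea npa]]].
  case: (graded_iso_surj (EP _ _ Ea)) => b Pb eb.
  exists m, b; split; first by split=> //; rewrite eb.
  by move=> pb; apply: npa; exists b.
move=> [m [b [[Pb Eb] npb]]]; rewrite -(Proj_pushK p); apply/e; exists m, (f b); split=> //.
by move/(push_idealE (Proj_prime p) Pb).
Qed.

Definition hfrac_map (x : hfrac B) : hfrac A :=
  HFrac (hdeg x) (f (hnum x)) (f (hden x)).

Lemma hfrac_at_map (p : Proj A) x : hfrac_at (Proj_pull p) x -> hfrac_at p (hfrac_map x).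
Proof.
case=> Pn Pd npd; split; try exact: graded_iso_piece.
by rewrite -Proj_pullE.
Qed.

Lemma hfrac_at_surj (p : Proj A) z : hfrac_at p z ->
  exists2 x, hfrac_at (Proj_pull p) x & hfrac_map x = z.
Proof.
case: z => k a b [/= /graded_iso_surj [a' Pa <-] /graded_iso_surj [b' Pb <-] npb].
by exists (HFrac k a' b') => //; split=> //= -[].
Qed.

(** [f] may fail to be injective on the ambient ring; equality of degrees puts the entries being
    compared in a common piece. *)
Lemma hfrac_map_inj (p q : Proj A) x y : hfrac_at (Proj_pull p) x ->
  hfrac_at (Proj_pull q) y -> hfrac_map x = hfrac_map y -> x = y.
Proof.
case: x y => [k a b] [l c d] [/= Pa Pb _] [/= Pc Pd _] [ekl eac ebd].
move: Pc Pd; rewrite -ekl => Pc Pd.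
by rewrite (graded_iso_inj Pa Pc eac) (graded_iso_inj Pb Pd ebd).
Qed.

Lemma hfrac_equiv_map (p : Proj A) x y :
  hfrac_at (Proj_pull p) x -> hfrac_at (Proj_pull p) y ->
  hfrac_equiv p (hfrac_map x) (hfrac_map y) <-> hfrac_equiv (Proj_pull p) x y.
Proof.
move=> [Px Qx _] [Py Qy _]; split=> [[k [_ [/graded_iso_surj [u Pu <-] npu]]]|].
  rewrite /= -!rmorphM -rmorphB -rmorphM => e.
  exists k, u; split=> //; first by rewrite Proj_pullE.
  apply: (@graded_iso_inj (k + (hdeg x + hdeg y))); rewrite ?rmorph0 //.
    apply: ga_pieceM => //; apply: ga_pieceB; first exact: ga_pieceM.
    by rewrite addnC; apply: ga_pieceM.
  exact: ga_piece0.
move=> [k [u [Pu npu e]]]; exists k, (f u); split; first exact: graded_iso_piece.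
  by rewrite -Proj_pullE.
by rewrite /= -!rmorphM -rmorphB -rmorphM e rmorph0.
Qed.

Lemma hfrac_class_map (p : Proj A) x y :
  hfrac_at (Proj_pull p) x -> hfrac_at (Proj_pull p) y ->
  hfrac_class p (hfrac_map x) (hfrac_map y) <-> hfrac_class (Proj_pull p) x y.
Proof.
move=> ax ay; split=> [[_ e]|[_ e]]; split=> //; try exact/hfrac_equiv_map.
exact: hfrac_at_map.
Qed.

Lemma hfrac_at_add (C : gradedAlg F) (p : Proj C) x y :
  hfrac_at p x -> hfrac_at p y -> hfrac_at p (hfrac_add x y).
Proof.
move=> [Px Qx nx] [Py Qy ny]; split=> /=.
- apply: ga_pieceD; first exact: ga_pieceM.
  by rewrite addnC; apply: ga_pieceM.
- exact: ga_pieceM.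
- by move=> /(hp_prime (Proj_prime p)) => /(_ Qx Qy) [].
Qed.

Lemma hfrac_at_mul (C : gradedAlg F) (p : Proj C) x y :
  hfrac_at p x -> hfrac_at p y -> hfrac_at p (hfrac_mul x y).
Proof.
move=> [Px Qx nx] [Py Qy ny]; split=> /=; try exact: ga_pieceM.
by move=> /(hp_prime (Proj_prime p)) => /(_ Qx Qy) [].
Qed.

Lemma hfrac_at_cst (C : gradedAlg F) (p : Proj C) c : hfrac_at p (hfrac_cst C c).
Proof.
by split=> /=; [apply: ga_pieceC | apply: ga_piece1 | apply: (hp_1 (Proj_prime p))].
Qed.

Lemma hfrac_map_add x y :
  hfrac_map (hfrac_add x y) = hfrac_add (hfrac_map x) (hfrac_map y).
Proof. by rewrite /hfrac_map /hfrac_add /= rmorphD !rmorphM. Qed.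

Lemma hfrac_map_mul x y :
  hfrac_map (hfrac_mul x y) = hfrac_mul (hfrac_map x) (hfrac_map y).
Proof. by rewrite /hfrac_map /hfrac_mul /= !rmorphM. Qed.

Lemma hfrac_map_cst c : hfrac_map (hfrac_cst B c) = hfrac_cst A c.
Proof. by rewrite /hfrac_map /hfrac_cst /= f_cst rmorph1. Qed.

Definition germs_map (s : germs B) : germs A :=
  fun p => [set hfrac_map x | x in s (Proj_pull p)].

(** Germs are literal sets of fractions, so an inverse of [germs_map] must return each class
    exactly; [hfrac_at] removes fractions that are inadmissible at [q]. *)
Definition germs_unmap (t : germs A) : germs B :=
  fun q => [set x | hfrac_at q x /\ t (Proj_push q) (hfrac_map x)].

Lemma Proj_sections_at (C : gradedAlg F) V s (p : Proj C) x :
  Proj_sections V s -> s p x -> hfrac_at p x.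
Proof.
move=> [s0 sV] spx; have Vp : V p.
  by apply: contrapT => nVp; move: spx; rewrite s0.
by case: (sV p Vp) => W [_ Wp _ [y /(_ p Wp) [_ e]]]; move: spx; rewrite e => -[].
Qed.

Lemma image_hfrac_class (p : Proj A) x : hfrac_at (Proj_pull p) x ->
  hfrac_map @` hfrac_class (Proj_pull p) x = hfrac_class p (hfrac_map x).
Proof.
move=> ax; apply/seteqP; split=> [_ [y cy <-]|z cz].
  by apply/hfrac_class_map => //; case: cy.
case: (hfrac_at_surj cz.1) => y ay e; rewrite -e in cz *.
by exists y => //; apply/hfrac_class_map.
Qed.

Lemma germs_map_sections V s : Proj_sections V s ->
  Proj_sections (Proj_pull @^-1` V) (germs_map s).
Proof.
move=> [s0 sV]; split=> p Vp.
  by rewrite /germs_map s0 // image_set0.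
case: (sV _ Vp) => W [Wo Wp WV [x sx]].
exists (Proj_pull @^-1` W); split=> //; first by apply/Proj_pull_open.
  by move=> q; apply: WV.
exists (hfrac_map x) => q /sx [ax e]; split; first exact: hfrac_at_map.
by rewrite /germs_map e image_hfrac_class.
Qed.

Lemma germs_mapK V s : Proj_sections V s -> germs_unmap (germs_map s) = s.
Proof.
move=> sV; apply/funext => q; apply/seteqP; split=> x.
  move=> [ax [y]]; rewrite Proj_pushK => sy e.
  rewrite -(Proj_pushK q) in ax sy.
  by rewrite -(hfrac_map_inj (Proj_sections_at sV sy) ax e) -(Proj_pushK q).
move=> sx; split; first exact: Proj_sections_at sV sx.
by exists x; rewrite ?Proj_pushK.
Qed.

Lemma germs_unmapK V t : Proj_sections (Proj_pull @^-1` V) t ->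
  germs_map (germs_unmap t) = t.
Proof.
move=> tV; apply/funext => p; apply/seteqP; split=> z.
  by move=> [x [ax]]; rewrite Proj_pullK => tx <-.
move=> tz; case: (hfrac_at_surj (Proj_sections_at tV tz)) => x ax e.
by exists x => //; split=> //; rewrite Proj_pullK e.
Qed.

Lemma germs_unmap_sections V t : Proj_sections (Proj_pull @^-1` V) t ->
  Proj_sections V (germs_unmap t).
Proof.
move=> [t0 tV]; split=> q Vq.
  apply/seteqP; split=> // x [_]; rewrite t0 //.
  by rewrite /preimage /= Proj_pushK.
have /tV [W [Wo Wp WV [z tz]]] : (Proj_pull @^-1` V) (Proj_push q).
  by rewrite /preimage /= Proj_pushK.
have eW : Proj_pull @^-1` (Proj_push @^-1` W) = W.
  by apply/seteqP; split=> p; rewrite /preimage /= Proj_pullK.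
exists (Proj_push @^-1` W); split=> //.
- by rewrite Proj_pull_open eW.
- by move=> r /WV; rewrite /preimage /= Proj_pushK.
(* The fraction representing [t] on [W] is lifted once; the same lift then works at every point of
   the neighbourhood. *)
have [x [Px Qx _] ex] := hfrac_at_surj (tz _ Wp).1; rewrite -{}ex in tz.
exists x => r Wr; have [[_ _ nr] er] := tz _ Wr.
have ax : hfrac_at (Proj_pull (Proj_push r)) x.
  by split=> //; rewrite Proj_pullE.
split; first by rewrite -(Proj_pushK r).
apply/seteqP; split=> y.
  move=> [ay]; rewrite er => cxy; rewrite -(Proj_pushK r) in ay *.
  exact/hfrac_class_map.
rewrite -{1}(Proj_pushK r) => cxy; split.
  by rewrite -(Proj_pushK r); case: cxy.
by rewrite er; apply/hfrac_class_map => //; case: cxy.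
Qed.

Lemma germs_map_op (opA : hfrac A -> hfrac A -> hfrac A)
    (opB : hfrac B -> hfrac B -> hfrac B) V s t :
  (forall x y, hfrac_map (opB x y) = opA (hfrac_map x) (hfrac_map y)) ->
  (forall q x y, hfrac_at q x -> hfrac_at q y -> hfrac_at q (opB x y)) ->
  Proj_sections V s -> Proj_sections V t ->
  germs_map (fun q => [set z | exists x y,
      [/\ s q x, t q y & hfrac_class q (opB x y) z]]) =
  fun p => [set z | exists x y,
      [/\ germs_map s p x, germs_map t p y & hfrac_class p (opA x y) z]].
Proof.
move=> map_op at_op sV tV; apply/funext => p; apply/seteqP; split=> z.
  move=> [u [x [y [sx ty cu]]] <-].
  exists (hfrac_map x), (hfrac_map y); split; [by exists x | by exists y |].
  rewrite -map_op; apply/hfrac_class_map => //; last by case: cu.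
  by apply: at_op; [apply: Proj_sections_at sV sx | apply: Proj_sections_at tV ty].
move=> [_ [_ [[x sx <-] [y ty <-]]]]; rewrite -map_op => cz.
have aop : hfrac_at (Proj_pull p) (opB x y).
  by apply: at_op; [apply: Proj_sections_at sV sx | apply: Proj_sections_at tV ty].
rewrite -image_hfrac_class // in cz; case: cz => u cu <-.
by exists u => //; exists x, y.
Qed.

(** Bijectivity piece by piece suffices, since primes, basic opens and degree-0 fractions involve
    homogeneous elements only. *)
Theorem graded_iso_Proj_iso : Proj_iso A B.
Proof.
exists Proj_pull, (fun _ => germs_map); split.
- by exists Proj_push; [apply: Proj_pullK | apply: Proj_pushK].
- exact: Proj_pull_open.
move=> V Vo; split.
- split.
  + by move=> s; apply: germs_map_sections.
  + move=> s t; rewrite !inE => sV tV e.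
    by rewrite -(germs_mapK sV) e (germs_mapK tV).
  + move=> t tV; exists (germs_unmap t); first exact: germs_unmap_sections.
    exact: germs_unmapK tV.
- by move=> s t; apply: germs_map_op hfrac_map_add (@hfrac_at_add B).
- by move=> s t; apply: germs_map_op hfrac_map_mul (@hfrac_at_mul B).
- move=> c; apply/funext => p; apply/seteqP; split=> z.
    move=> [x [Vp cx] <-]; split=> //; rewrite -hfrac_map_cst.
    apply/hfrac_class_map => //; [exact: hfrac_at_cst | by case: cx].
  move=> [Vp]; rewrite -hfrac_map_cst -image_hfrac_class; last exact: hfrac_at_cst.
  by move=> [x cx <-]; exists x.
- move=> W s _ _ _; apply/funext => p; apply/seteqP; split=> z.
    by move=> [x [Wp sx] <-]; split=> //; exists x.
  by move=> [Wp [x sx <-]]; exists x.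
Qed.

End GradedIso.

(** * Polynomial identities *)

(** In characteristic 0 the natural numbers provide more roots than the degree allows. *)
Lemma poly_eq0_horner (F : numDomainType) (p : {poly F}) :
  (forall s, p.[s] = 0) -> p = 0.
Proof.
move=> p0; apply/eqP; apply: contraT => nz_p.
pose rs := [seq k%:R : F | k <- iota 0 (size p)].
have := max_poly_roots (rs := rs) nz_p; rewrite size_map size_iota ltnn; apply.
  by apply/allP => s _; apply/rootP.
by rewrite map_inj_uniq ?iota_uniq // => k l /eqP; rewrite eqr_nat => /eqP.
Qed.

Lemma poly_eq_horner (F : numDomainType) (p q e : {poly F}) : e != 0 ->
  (forall s, e.[s] != 0 -> p.[s] = q.[s]) -> p = q.
Proof.
move=> nz_e pq; apply/eqP; rewrite -subr_eq0.
have /eqP : (p - q) * e = 0.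
  apply: poly_eq0_horner => s; rewrite hornerM hornerD hornerN.
  have [->|/pq ->] := eqVneq e.[s] 0; first by rewrite mulr0.
  by rewrite subrr mul0r.
by rewrite mulf_eq0 (negbTE nz_e) orbF.
Qed.

(** The lowest digit is the residue modulo [b]; the quotient is handled by induction. *)
Lemma digits_inj (b n : nat) (k l : 'I_n -> nat) :
  (forall i, k i < b)%N -> (forall i, l i < b)%N ->
  (\sum_(i < n) k i * b ^ i = \sum_(i < n) l i * b ^ i)%N -> k =1 l.
Proof.
elim: n k l => [|n IH] k l kb lb; first by move=> _ [].
have E (u : 'I_n.+1 -> nat) : (\sum_(i < n.+1) u i * b ^ i =
    (\sum_(i < n) u (lift ord0 i) * b ^ i) * b + u ord0)%N.
  rewrite big_ord_recl expn0 muln1 addnC big_distrl /=; congr (_ + _)%N.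
  by apply: eq_bigr => i _; rewrite -mulnA -expnSr.
have b0 : (0 < b)%N by apply: leq_ltn_trans (kb ord0).
rewrite !E => e.
have e0 : k ord0 = l ord0.
  by move/(congr1 (modn^~ b)): e; rewrite !modnMDl !modn_small.
have e1 : (\sum_(i < n) k (lift ord0 i) * b ^ i =
           \sum_(i < n) l (lift ord0 i) * b ^ i)%N.
  by move: e; rewrite e0 => /addIn /eqP; rewrite eqn_pmul2r // => /eqP.
move=> i; case: (unliftP ord0 i) => [i'|] -> //.
by apply: (IH (fun i => k (lift ord0 i)) (fun i => l (lift ord0 i))).
Qed.

(* Kronecker substitution: [x_i := s ^ (b ^ i)], with [b] larger than the      *)
(* degree of [p], keeps distinct monomials of [p] apart.                       *)
Lemma mpoly_eq0_meval (F : numDomainType) n (p : {mpoly F[n]}) :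
  (forall v, p.@[v] = 0) -> p = 0.
Proof.
move=> p0; apply/mpolyP => m; rewrite mcoeff0.
have [m_p|] := boolP (m \in msupp p); last exact: memN_msupp_eq0.
pose b := msize p; pose key (m : 'X_{1..n}) := (\sum_(i < n) m i * b ^ i)%N.
have key_inj m1 m2 : m1 \in msupp p -> m2 \in msupp p -> key m1 = key m2 -> m1 = m2.
  have small m' : m' \in msupp p -> forall i, (m' i < b)%N.
    move=> /msize_mdeg_lt lt_m' i; apply: leq_ltn_trans lt_m'.
    by rewrite mdegE (bigD1 i) //= leq_addr.
  by move=> /small b1 /small b2 /(digits_inj b1 b2) e; apply/mnmP.
pose P : {poly F} := \sum_(m' <- msupp p) p@_m' *: 'X^(key m').
have P0 : P = 0.
  apply: poly_eq0_horner => s; rewrite -[RHS](p0 (fun i => s ^+ (b ^ i))) mevalE.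
  rewrite /P horner_sum; apply: eq_bigr => m' _.
  rewrite hornerZ hornerXn; congr (_ * _).
  rewrite /key expr_sum; apply: eq_bigr => i _.
  by rewrite -exprM mulnC.
have := congr1 (fun P : {poly F} => P`_(key m)) P0.
rewrite /P coef_sum coef0 (bigD1_seq m) ?msupp_uniq //= coefZ coefXn eqxx mulr1.
rewrite big_seq_cond big1 ?addr0 // => m' /andP[m'_p nm'].
rewrite coefZ coefXn; case: eqP => [/(key_inj _ _ m_p m'_p) e|]; last by rewrite mulr0.
by rewrite e eqxx in nm'.
Qed.

Lemma rmorph_mmap (F : comNzRingType) (S : comNzRingType) n (ev : {rmorphism S -> F})
    (iota : {rmorphism F -> S}) (v : 'I_n -> S) (q : {mpoly F[n]}) :
  cancel iota ev -> ev (mmap iota v q) = q.@[ev \o v].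
Proof.
move=> iotaK; rewrite mevalE /mmap rmorph_sum; apply: eq_bigr => m _.
rewrite rmorphM iotaK /mmap1 rmorph_prod; congr (_ * _).
by apply: eq_bigr => i _; rewrite rmorphXn.
Qed.

Lemma dhomog_meval (F : comNzRingType) n m (p : {mpoly F[n]}) (c : F) v :
  p \is m.-homog -> p.@[fun i => c * v i] = c ^+ m * p.@[v].
Proof.
move=> /dhomogP p_m; rewrite !mevalE mulr_sumr big_seq [RHS]big_seq.
apply: eq_bigr => k /p_m <-; rewrite mulrCA; congr (_ * _).
rewrite -[X in c ^+ X]/(mdeg k) mdegE expr_sum -big_split /=; apply: eq_bigr => i _.
by rewrite exprMn.
Qed.

(** * Degree bounds and homogenization *)

Section Homogenize.
Variables (F : numFieldType) (d : nat) (p : {mpoly F[d.+1]}) (m : nat).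
Hypothesis p_deg : forall z, exists r : {poly F},
  forall s, s != 0 -> r.[s] = s ^+ m * p.@[fun l => z l / s].

Lemma meval_scaled z s k : (msize p <= k)%N -> s != 0 ->
  p.@[fun l => z l / s] = \sum_(e < k) s ^- e * (pihomog mdeg e p).@[z].
Proof.
move=> kp nz_s; rewrite {1}(pihomog_partitionE kp) raddf_sum /=.
apply: eq_bigr => e _; rewrite -exprVn -(dhomog_meval _ _ (pihomogP _ _ _)).
by apply: meval_eq => l; rewrite mulrC.
Qed.

(** The part of degree e enters s^m p(z / s) with the power s^(m - e), and a polynomial in s has no
    negative powers. *)
Lemma pihomog_meval_eq0 z e : (m < e)%N -> (pihomog mdeg e p).@[z] = 0.
Proof.
move=> lt_me; have [r rE] := p_deg z.
(* Multiplication by ['X^k] clears the negative powers. Since m < e, the coefficient of index k + m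
   - e lies below k, so it vanishes on the left. *)
pose k := maxn (msize p) e.+1.
have lt_ek : (e < k)%N by rewrite leq_max leqnn orbT.
have /(congr1 (fun P : {poly F} => P`_(k + m - e))) : 'X^k * r =
    \sum_(e' < k) (pihomog mdeg e' p).@[z] *: 'X^(k + m - e').
  apply: (poly_eq_horner (e := 'X)); first by rewrite polyX_eq0.
  move=> s; rewrite hornerX => nz_s.
  rewrite hornerM hornerXn rE // (@meval_scaled z s k) ?leq_maxl //.
  rewrite mulrA -exprD mulr_sumr horner_sum; apply: eq_bigr => e' _.
  rewrite hornerZ hornerXn mulrA mulrC; congr (_ * _).
  rewrite -expfB_cond ?(negbTE nz_s) //=.
  by rewrite (leq_trans (ltnW (ltn_ord e'))) ?leq_addr.
rewrite coefXnM ltn_subLR; last by rewrite (leq_trans (ltnW lt_ek)) ?leq_addr.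
rewrite [(e + k)%N]addnC ltn_add2l lt_me => /esym.
rewrite coef_sum (bigD1 (Ordinal lt_ek)) //= coefZ coefXn eqxx mulr1 big1 ?addr0 //.
move=> e' ne; rewrite coefZ coefXn; case: eqP; rewrite ?mulr0 // => eq_e.
case/eqP: ne; apply: val_inj => /=.
have h1 : (e <= k + m)%N by rewrite (leq_trans (ltnW lt_ek)) ?leq_addr.
have h2 : (e' <= k + m)%N by rewrite (leq_trans (ltnW (ltn_ord e'))) ?leq_addr.
by rewrite -[LHS](subKn h2) -eq_e subKn.
Qed.

(** The part of degree e is completed by the power m - e of the variable 0; the parts above m vanish
    by [pihomog_meval_eq0]. *)
Lemma homogenize_meval : exists2 Q : {mpoly F[d.+1]}, Q \is m.-homog &
  forall y, y ord0 != 0 ->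
    Q.@[y] = y ord0 ^+ m * p.@[fun l => y l / y ord0].
Proof.
exists (\sum_(e < m.+1) 'X_ord0 ^+ (m - e) * pihomog mdeg e p).
  apply: rpred_sum => e _; have em : (m - e + e)%N = m by rewrite subnK // -ltnS.
  rewrite -[in X in _ \in X]em.
  apply: dhomogM; last exact: pihomogP.
  have /(dhomogMn (m - e)) : ('X_ord0 : {mpoly F[d.+1]}) \is 1.-homog.
    by rewrite dhomogX; apply/eqP; apply: mdeg1.
  by rewrite mul1n.
move=> y nz_y; rewrite (@meval_scaled y _ (m.+1 + msize p)) ?leq_addl //.
rewrite big_split_ord /= [X in _ + X]big1 ?addr0; last first.
  by move=> e _; rewrite pihomog_meval_eq0 ?mulr0 // ltnS leq_addr.
rewrite mulr_sumr rmorph_sum; apply: eq_bigr => e _ /=.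
rewrite mevalM rmorphXn /= mevalXU mulrA; congr (_ * _).
by rewrite expfB_cond // (negbTE nz_y) -ltnS ltn_ord.
Qed.

End Homogenize.

(** * Flags and charts *)

(** Two triangular factorizations of one block matrix are compared. No division occurs, so families
    over polynomial rings are covered. *)
Lemma det_1Dmul (S : comNzRingType) n (u : 'cV[S]_n) (v : 'rV[S]_n) :
  \det (1%:M + u *m v) = 1 + (v *m u) 0 0.
Proof.
pose M := block_mx 1%:M (- v) u 1%:M.
have e1 : M = block_mx 1%:M 0 u 1%:M *m block_mx 1%:M (- v) 0 (1%:M + u *m v).
  rewrite mulmx_block !(mul1mx, mul0mx, mulmx0, mulmx1) !addr0 mulmxN.
  by rewrite addrCA addNr addr0.
have e2 : M = block_mx (1%:M + v *m u) (- v) 0 1%:M *m block_mx 1%:M 0 u 1%:M.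
  rewrite mulmx_block !(mul1mx, mul0mx, mulmx0, mulmx1) !add0r mulNmx.
  by rewrite addrK.
have := congr1 determinant e2; rewrite {1}e1 !det_mulmx !det_lblock !det_ublock.
by rewrite !det1 !mul1r !mulr1 => ->; rewrite det_mx11 !mxE eqxx.
Qed.

Section LineHyperplane.
Variables (S : comNzRingType) (N : nat).
Local Notation n := N.+2.
Implicit Types (M : 'M[S]_n) (x : 'cV[S]_n) (xi : 'rV[S]_n).

(* The point of G/P attached to [M] in SL_n is the flag (line, hyperplane)     *)
(* with line spanned by [lin M] and hyperplane the kernel of [hyp M].          *)
Definition lin M : 'cV[S]_n := col ord0 M.
Definition hyp M : 'rV[S]_n := row ord_max (\adj M).

Lemma linE M k : lin M k 0 = M k ord0. Proof. by rewrite !mxE. Qed.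

Lemma lin_mul M M' : lin (M *m M') = M *m lin M'.
Proof. by rewrite /lin !colE mulmxA. Qed.

Lemma hyp_unique M xi : \det M = 1 -> xi *m M = delta_mx 0 ord_max -> hyp M = xi.
Proof.
move=> dM e; rewrite /hyp rowE -e -mulmxA mul_mx_adj dM mulmx1 //.
Qed.

Lemma hyp_mulmx M : \det M = 1 -> hyp M *m M = delta_mx 0 ord_max.
Proof. by move=> dM; rewrite /hyp rowE -mulmxA mul_adj_mx dM mulmx1. Qed.

Lemma hyp_lin M : \det M = 1 -> hyp M *m lin M = 0.
Proof.
move=> dM; rewrite /lin colE mulmxA hyp_mulmx // mul_delta_mx_0 //.
Qed.

Variables i k : 'I_n.
Hypothesis ik : i != k.

(* When [x i 0 = xi 0 k = 1] the entries need no division, so that families  *)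
(* of flags over polynomial rings lift to families of matrices.               *)
Definition chart x xi : 'M[S]_n :=
  (1%:M - delta_mx k 0 *m (xi - delta_mx 0 k)) *m
  (1%:M + (x - x k 0 *: delta_mx k 0 - delta_mx i 0) *m delta_mx 0 i).

Lemma mul_delta_col m (A : 'M[S]_(m, n)) (l : 'I_n) a :
  (A *m delta_mx l (0 : 'I_1)) a 0 = A a l.
Proof. by rewrite -colE mxE. Qed.

Lemma mul_delta_row m (A : 'M[S]_(n, m)) (l : 'I_n) b :
  (delta_mx (0 : 'I_1) l *m A) 0 b = A l b.
Proof. by rewrite -rowE mxE. Qed.

Lemma mul_delta_rc (l l' : 'I_n) :
  delta_mx (0 : 'I_1) l *m delta_mx l' (0 : 'I_1) = (l == l')%:R%:M :> 'M[S]_1.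
Proof.
rewrite mul_delta_mx_cond; apply/matrixP => a b; rewrite !ord1.
by case: eqP; rewrite ?mulr1n ?mulr0n !mxE ?mul0rn ?eqxx.
Qed.

Variables (x : 'cV[S]_n) (xi : 'rV[S]_n).
Hypotheses (x1 : x i 0 = 1) (xi1 : xi 0 k = 1) (xi_x : xi *m x = 0).

Lemma det_chart : \det (chart x xi) = 1.
Proof.
rewrite det_mulmx -mulNmx !det_1Dmul mulmxN mxE mul_delta_col mul_delta_row.
rewrite !mxE !eqxx xi1 x1 (negbTE ik) /= subrr oppr0 addr0.
by rewrite mulr0 subr0 subrr addr0 mulr1.
Qed.

(** The second factor sends e_i to x with its entry at k removed; the first restores that entry
    because xi x = 0. *)
Lemma chart_col : chart x xi *m delta_mx i 0 = x.
Proof.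
have -> : chart x xi *m delta_mx i 0 =
    (1%:M - delta_mx k 0 *m (xi - delta_mx 0 k)) *m (x - x k 0 *: delta_mx k 0).
  rewrite /chart -mulmxA mulmxDl mul1mx -(mulmxA _ _ (delta_mx i 0)).
  by rewrite mul_delta_rc eqxx mulmx1 [delta_mx i 0 + _]addrC subrK.
rewrite mulmxBl mul1mx -mulmxA mulmxBl !mulmxBr xi_x -!scalemxAr mul_delta_rc eqxx.
rewrite [xi *m _]mx11_scalar mul_delta_col xi1 -rowE [row k x]mx11_scalar.
rewrite mulmx0 sub0r [row k x 0 0]mxE !mul_mx_scalar !scale1r subrr subr0 opprK.
by rewrite subrK.
Qed.


(** The first factor already turns xi into the row e_k, which the second fixes because the entry of
    x at k was removed. *)
Lemma chart_row : xi *m chart x xi = delta_mx 0 k.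
Proof.
rewrite /chart mulmxA mulmxBr mulmx1 mulmxA [xi *m delta_mx _ _]mx11_scalar.
rewrite mul_delta_col xi1 mul1mx opprB addrC subrK mulmxDr mulmx1 mulmxA.
rewrite !mulmxBr -scalemxAr !mul_delta_rc eqxx eq_sym (negbTE ik).
rewrite -rowE [row k x]mx11_scalar mxE scale_scalar_mx mulr1 subrr sub0r.
by rewrite mulNmx raddf0 mul0mx oppr0 addr0.
Qed.

End LineHyperplane.

Section Maps.
Variables (S S' : comNzRingType) (ev : {rmorphism S -> S'}) (N : nat).
Local Notation n := N.+2.

Lemma map_lin (M : 'M[S]_n) : map_mx ev (lin M) = lin (map_mx ev M).
Proof. by rewrite /lin map_col. Qed.

Lemma map_hyp (M : 'M[S]_n) : map_mx ev (hyp M) = hyp (map_mx ev M).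
Proof. by rewrite /hyp map_row map_mx_adj. Qed.

Lemma map_chart i k (x : 'cV[S]_n) xi :
  map_mx ev (chart i k x xi) = chart i k (map_mx ev x) (map_mx ev xi).
Proof.
rewrite /chart map_mxM map_mxB map_mxD !map_mxM !map_mxB map_mxZ !map_delta_mx.
by rewrite !map_mx1 mxE.
Qed.

End Maps.

(** * Effect of a transvection on a flag *)

Section Transvection.
Variables (S : comNzRingType) (N : nat).
Local Notation n := N.+2.

Lemma mulmx_1Dmul (v : 'rV[S]_n) (u : 'cV[S]_n) (r : 'rV[S]_n) :
  v *m (1%:M + u *m r) = v + (v *m u) 0 0 *: r.
Proof. by rewrite mulmxDr mulmx1 mulmxA {1}[v *m u]mx11_scalar mul_scalar_mx. Qed.

Lemma mul1Dmul_mx (x : 'cV[S]_n) (u : 'cV[S]_n) (r : 'rV[S]_n) :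
  (1%:M + u *m r) *m x = x + (r *m x) 0 0 *: u.
Proof. by rewrite mulmxDl mul1mx -mulmxA {1}[r *m x]mx11_scalar mul_mx_scalar. Qed.

Variables (M : 'M[S]_n) (u : 'cV[S]_n) (r : 'rV[S]_n).
Hypotheses (dM : \det M = 1) (ru : r *m u = 0).

Lemma det_transv_mul : \det ((1%:M + u *m r) *m M) = 1.
Proof. by rewrite det_mulmx det_1Dmul ru dM mxE addr0 mulr1. Qed.

Lemma lin_transv_mul :
  lin ((1%:M + u *m r) *m M) = lin M + (r *m lin M) 0 0 *: u.
Proof. by rewrite lin_mul mul1Dmul_mx. Qed.

(** As r u = 0, the inverse of 1 + u r is 1 - u r. *)
Lemma hyp_transv_mul :
  hyp ((1%:M + u *m r) *m M) = hyp M - (hyp M *m u) 0 0 *: r.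
Proof.
apply: hyp_unique; first exact: det_transv_mul.
rewrite mulmxA mulmx_1Dmul mulmxBl -scalemxAl ru scaler0 subr0 subrK.
exact: hyp_mulmx.
Qed.

Lemma hyp_transv_mulE k : hyp ((1%:M + u *m r) *m M) 0 k =
  hyp M 0 k - (hyp M *m u) 0 0 * r 0 k.
Proof.
by rewrite hyp_transv_mul mxE; congr (_ + _); rewrite mxE; congr (- _); rewrite mxE.
Qed.

End Transvection.

(** * Charts with prescribed line and hyperplane in SL_n *)

Section SLChart.
Variables (F : numClosedFieldType) (N : nat).
Local Notation n := N.+2.
Implicit Types (w : 'S_n) (x : 'cV[F]_n) (xi : 'rV[F]_n).

Definition perm_scale w : F := n.-root ((-1) ^+ w).

(* A scalar rather than a sign in one column corrects the determinant: [lin]  *)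
(* and [hyp] then scale inversely and the products x_k xi_k are unchanged.    *)
Definition perm_sl w : 'M[F]_n := perm_scale w *: perm_mx w^-1.

Lemma perm_scaleX w : perm_scale w ^+ n = (-1) ^+ w.
Proof. by rewrite rootCK. Qed.

Lemma perm_scale_neq0 w : perm_scale w != 0.
Proof.
by have := expf_eq0 (perm_scale w) n; rewrite perm_scaleX signr_eq0 => /esym/negbT.
Qed.

Lemma det_perm_sl w : \det (perm_sl w) = 1.
Proof. by rewrite detZ det_perm odd_permV perm_scaleX -signr_addb addbb. Qed.

Lemma perm_slE w a b : perm_sl w a b = perm_scale w * (a == w b)%:R.
Proof. by rewrite !mxE -(inj_eq (@perm_inj _ w)) permKV. Qed.

Lemma lin_perm_sl w : lin (perm_sl w) = perm_scale w *: delta_mx (w ord0) 0.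
Proof. by apply/matrixP => a b; rewrite ord1 linE perm_slE !mxE andbT. Qed.

Lemma row_perm_sl w : delta_mx (0 : 'I_1) (w ord_max) *m perm_sl w =
  perm_scale w *: delta_mx 0 ord_max.
Proof.
apply/matrixP => a b; rewrite ord1 mul_delta_row perm_slE !mxE eqxx /=.
by rewrite (inj_eq (@perm_inj _ w)) eq_sym.
Qed.

(** [perm_sl] brings the normalised indices to the first column and the last row, where [lin] and
    [hyp] read them. *)
Definition sl_chart w x xi : 'M[F]_n :=
  chart (w ord0) (w ord_max) x xi *m perm_sl w.

Lemma perm_ends_neq w : w ord0 != w ord_max.
Proof. by rewrite (inj_eq (@perm_inj _ w)). Qed.

Lemma perm_with_ends (i k : 'I_n) : i != k ->
  exists w : 'S_n, w ord0 = i /\ w ord_max = k.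
Proof.
move=> ik; exists (tperm ord0 i * tperm (tperm ord0 i ord_max) k)%g.
have ni : tperm ord0 i ord_max != i.
  by apply/eqP => e; have /perm_inj := etrans e (esym (tpermL ord0 i)).
have ki : k != i by rewrite eq_sym.
by rewrite !permM !tpermL (tpermD ni ki).
Qed.

Variables (w : 'S_n) (x : 'cV[F]_n) (xi : 'rV[F]_n).
Hypotheses (x1 : x (w ord0) 0 = 1) (xi1 : xi 0 (w ord_max) = 1).
Hypothesis xi_x : xi *m x = 0.

Lemma det_sl_chart : \det (sl_chart w x xi) = 1.
Proof. by rewrite det_mulmx det_chart ?perm_ends_neq // det_perm_sl mulr1. Qed.

Lemma lin_sl_chart : lin (sl_chart w x xi) = perm_scale w *: x.
Proof. by rewrite lin_mul lin_perm_sl -scalemxAr chart_col ?perm_ends_neq. Qed.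

Lemma hyp_sl_chart : hyp (sl_chart w x xi) = (perm_scale w)^-1 *: xi.
Proof.
apply: hyp_unique; first exact: det_sl_chart.
rewrite -scalemxAl mulmxA chart_row ?perm_ends_neq // row_perm_sl.
by rewrite scalerA mulVf ?scale1r // perm_scale_neq0.
Qed.

End SLChart.

Section Eval.
Variables (F : closedFieldType) (N : nat) (S : comNzRingType).
Variables (ev : {rmorphism S -> F}) (iota : {rmorphism F -> S}).
Hypothesis iotaK : cancel iota ev.
Local Notation n := N.+2.

(** For [S] a polynomial ring this exhibits [q] along a family of matrices as a polynomial in the
    parameters. *)
Definition mmap_mx (q : {mpoly F[n * n]}) (M : 'M[S]_n) : S :=
  mmap iota (fun k => mxvec M 0 k) q.

Lemma mmap_mxE q M : ev (mmap_mx q M) = eval_mx q (map_mx ev M).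
Proof.
rewrite rmorph_mmap // /eval_mx -map_mxvec; apply: meval_eq => k /=.
by rewrite mxE.
Qed.

Lemma map_mx_cst m p (M : 'M[F]_(m, p)) : map_mx ev (map_mx iota M) = M.
Proof. by apply/matrixP => a b; rewrite !mxE. Qed.

End Eval.

(** * Invariant functions on the Bruhat cell *)

Section Core.
Variables (F : numClosedFieldType) (N : nat) (w : 'S_N.+2).
Local Notation n := N.+2.
Local Notation i := (w ord0).
Local Notation j := (w ord_max).

Definition in_cell (M : 'M[F]_n) : Prop :=
  [/\ \det M = 1, forall k : 'I_n, (i < k)%N -> lin M k 0 = 0, lin M i 0 != 0,
      forall k : 'I_n, (k < j)%N -> hyp M 0 k = 0 & hyp M 0 j != 0].

(** This merges left translation by T and right translation by P: x is multiplied by t and xi by c /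
    t, with no determinant condition on t, and c is the resulting value of [alpha0]. *)
Definition cell_equivariant (m : nat) (f : 'M[F]_n -> F) : Prop :=
  forall M M' (t : 'I_n -> F) c, in_cell M -> \det M' = 1 ->
    (forall k, t k != 0) -> c != 0 ->
    (forall k, lin M' k 0 = t k * lin M k 0) ->
    (forall k, hyp M' 0 k * t k = c * hyp M 0 k) -> f M' = c ^+ m * f M.

(** Take M' = M and c = 2: t is 1 on the support of x and 2 on that of xi, which are disjoint when i
    < j. *)
Lemma cell_equivariant_lt m f M : cell_equivariant m f -> (0 < m)%N -> (i < j)%N ->
  in_cell M -> f M = 0.
Proof.
move=> fE m0 ij cM; have [dM x0 _ xi0 _] := cM.
have nz2 : (2 : F) != 0 by rewrite pnatr_eq0.
pose t (k : 'I_n) : F := if (k <= i)%N then 1 else 2.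
have e : f M = 2 ^+ m * f M.
  apply: (fE M M t) => // k; rewrite /t; case: leqP => ki; rewrite ?oner_neq0 ?mul1r //.
  - by rewrite x0 // mulr0.
  - by rewrite xi0 ?(leq_ltn_trans ki) // mul0r mulr0.
  - by rewrite mulrC.
apply/eqP; have /eqP : (2 ^+ m - 1) * f M = 0 by rewrite mulrBl mul1r -e subrr.
rewrite mulf_eq0 subr_eq0 => /orP[|//].
by rewrite pexpr_eq1 ?ler0n // pnatr_eq1.
Qed.

Hypothesis ji : (j < i)%N.

(** The i - j products y_k with j <= k < i become the homogeneous coordinates. *)
Definition cell_dim := (i - j).-1.
Local Notation d := cell_dim.

Definition mid (l : 'I_d.+1) : 'I_n := inord (j + l).

Lemma val_mid l : mid l = (j + l)%N :> nat.
Proof. by rewrite inordK //; have := ltn_ord l; have := ltn_ord i; rewrite /d; lia. Qed.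

Lemma mid_lt l : (mid l < i)%N.
Proof. by rewrite val_mid; have := ltn_ord l; rewrite /d; lia. Qed.

Lemma mid_ge l : (j <= mid l)%N.
Proof. by rewrite val_mid leq_addr. Qed.

Lemma mid0 : mid ord0 = j.
Proof. by apply: val_inj; rewrite /= val_mid addn0. Qed.

Lemma midP (k : 'I_n) : (j <= k < i)%N -> exists l, k = mid l.
Proof.
move=> /andP[jk ki]; have lt_d : (k - j < d.+1)%N by rewrite /d; lia.
by exists (Ordinal lt_d); apply: val_inj; rewrite /= val_mid /= subnKC.
Qed.

(** * The slice of flags with x = (1, ..., 1, 0, ..., 0) *)

Section Generic.
Variable S : comNzRingType.
Implicit Types (x : 'cV[S]_n) (xi : 'rV[S]_n) (z : 'I_d.+1 -> S).

Lemma sum_mid (G : 'I_n -> S) : \sum_(k < n | (j <= k < i)%N) G k = \sum_l G (mid l).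
Proof.
pose back (k : 'I_n) : 'I_d.+1 := inord (k - j).
rewrite (reindex_onto mid back) => [|k /midP[l ->]]; last first.
  by congr mid; apply: val_inj; rewrite /= inordK val_mid addKn.
apply: eq_bigl => l; rewrite mid_ge mid_lt; apply/eqP/val_inj.
by rewrite /= inordK val_mid addKn.
Qed.

Lemma dot_mid x xi : (forall k : 'I_n, (i < k)%N -> x k 0 = 0) ->
  (forall k : 'I_n, (k < j)%N -> xi 0 k = 0) ->
  (xi *m x) 0 0 = \sum_l xi 0 (mid l) * x (mid l) 0 + xi 0 i * x i 0.
Proof.
move=> x0 xi0; rewrite mxE (bigD1 i) //= addrC; congr (_ + _).
rewrite -(sum_mid (fun k => xi 0 k * x k 0)) (bigID (fun k : 'I_n => j <= k < i)%N) /=.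
rewrite [X in _ + X]big1 ?addr0 => [|k /andP[ki nk]].
  apply: eq_bigl => k; case: eqP => [->|_] //=; by rewrite ltnn andbF.
have [kj|jk] := ltnP k j; first by rewrite xi0 // mul0r.
rewrite x0 ?mulr0 //; move: nk; rewrite jk /= -leqNgt leq_eqVlt => /orP[|//].
by move/eqP/val_inj => e; rewrite e eqxx in ki.
Qed.

Definition base_x : 'cV[S]_n := \col_k (k <= i)%:R.

(* On the flag [(base_x, base_xi z)] the coordinates [ymon] below take the    *)
(* values [z]; the entry at [i] is forced by incidence.                       *)
Definition base_xi z : 'rV[S]_n :=
  \row_k if (k < j)%N then 0 else if (k < i)%N then z (inord (k - j))
         else if k == i then - \sum_l z l else 1.

Lemma base_x_i : base_x i 0 = 1. Proof. by rewrite mxE leqnn. Qed.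

Lemma base_xE (k : 'I_n) : (k <= i)%N -> base_x k 0 = 1. Proof. by rewrite mxE => ->. Qed.

Lemma base_x_gt (k : 'I_n) : (i < k)%N -> base_x k 0 = 0.
Proof. by rewrite mxE ltnNge => /negbTE ->. Qed.

Lemma base_xi_mid z l : base_xi z 0 (mid l) = z l.
Proof.
rewrite mxE ltnNge mid_ge mid_lt /=; congr z; apply: val_inj.
by rewrite /= inordK val_mid addKn.
Qed.

Lemma base_xi_lt z (k : 'I_n) : (k < j)%N -> base_xi z 0 k = 0.
Proof. by rewrite mxE => ->. Qed.

Lemma base_xi_gt z (k : 'I_n) : (i < k)%N -> base_xi z 0 k = 1.
Proof.
move=> ik; rewrite mxE ltnNge (ltnW (ltn_trans ji ik)) ltnNge (ltnW ik) /=.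
by rewrite -val_eqE gtn_eqF.
Qed.

Lemma base_xi_i z : base_xi z 0 i = - \sum_l z l.
Proof. by rewrite mxE ltnNge (ltnW ji) ltnn eqxx. Qed.

Lemma base_xi_x z : base_xi z *m base_x = 0.
Proof.
apply/matrixP => a b; rewrite !ord1 dot_mid; first last.
- exact: base_xi_lt.
- exact: base_x_gt.
rewrite base_xi_i base_x_i mulr1 mxE; apply/eqP; rewrite subr_eq0; apply/eqP.
by apply: eq_bigr => l _; rewrite base_xi_mid base_xE ?mulr1 // ltnW ?mid_lt.
Qed.

Definition ymon (M : 'M[S]_n) (l : 'I_d.+1) : S := lin M (mid l) 0 * hyp M 0 (mid l).

Definition set0th (s : S) z : 'I_d.+1 -> S := fun l => if l == ord0 then s else z l.

End Generic.

Lemma map_base_x (S S' : comNzRingType) (ev : {rmorphism S -> S'}) :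
  map_mx ev (base_x S) = base_x S'.
Proof. by apply/matrixP => a b; rewrite !mxE rmorph_nat. Qed.

Lemma map_base_xi (S S' : comNzRingType) (ev : {rmorphism S -> S'}) z :
  map_mx ev (base_xi z) = base_xi (ev \o z).
Proof.
apply/matrixP => a b; rewrite !mxE; do ! case: ifP => _ //; rewrite ?rmorph0 ?rmorph1 //.
by rewrite rmorphN rmorph_sum.
Qed.

Lemma base_xi_ext (S : comNzRingType) (z z' : 'I_d.+1 -> S) :
  z =1 z' -> base_xi z = base_xi z'.
Proof. by move=> /funext ->. Qed.

Definition base_mx (z : 'I_d.+1 -> F) : 'M[F]_n :=
  sl_chart w (base_x F) (base_xi (set0th 1 z)).

Lemma base_xi_j (S : comNzRingType) (z : 'I_d.+1 -> S) : base_xi z 0 j = z ord0.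
Proof. by rewrite -mid0 base_xi_mid. Qed.

Lemma lin_base_mx z : lin (base_mx z) = perm_scale F w *: base_x F.
Proof. by rewrite lin_sl_chart ?base_x_i ?base_xi_j ?base_xi_x. Qed.

Lemma hyp_base_mx z : hyp (base_mx z) = (perm_scale F w)^-1 *: base_xi (set0th 1 z).
Proof. by rewrite hyp_sl_chart ?base_x_i ?base_xi_j ?base_xi_x. Qed.

Lemma base_mx_cell z : in_cell (base_mx z).
Proof.
have nz := perm_scale_neq0 F w; split.
- by rewrite det_sl_chart ?base_x_i ?base_xi_j ?base_xi_x.
- by move=> k ik; rewrite lin_base_mx mxE base_x_gt ?mulr0.
- by rewrite lin_base_mx mxE base_x_i mulr1.
- by move=> k kj; rewrite hyp_base_mx mxE base_xi_lt ?mulr0.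
- by rewrite hyp_base_mx mxE base_xi_j mulr1 invr_eq0.
Qed.

Lemma ymon_base_mx z l : ymon (base_mx z) l = set0th 1 z l.
Proof.
rewrite /ymon lin_base_mx hyp_base_mx mxE [X in _ * X]mxE base_xi_mid.
rewrite base_xE ?(ltnW (mid_lt l)) //.
by rewrite mulr1 mulrA mulfV ?mul1r // perm_scale_neq0.
Qed.

Lemma sum_ymon M : in_cell M -> \sum_l ymon M l = - (lin M i 0 * hyp M 0 i).
Proof.
move=> [dM x0 _ xi0 _]; have := congr1 (fun A : 'M_1 => A 0 0) (hyp_lin dM).
rewrite dot_mid // [RHS]mxE => /eqP; rewrite addr_eq0 => /eqP e.
by rewrite mulrC -e; apply: eq_bigr => l _; rewrite mulrC.
Qed.

(** * Invariants on the slice and on the whole cell *)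

Section Function.
Variables (m : nat) (q : {mpoly F[n * n]}).
Hypothesis qE : cell_equivariant m (eval_mx q).

Definition base_poly : {mpoly F[d.+1]} :=
  mmap_mx (@mpolyC d.+1 F) q
    (chart i j (base_x _) (base_xi (set0th 1 (fun l => 'X_l))) *m
     map_mx (@mpolyC d.+1 F) (perm_sl F w)).

Lemma base_polyE z : base_poly.@[z] = eval_mx q (base_mx z).
Proof.
rewrite (mmap_mxE (ev := meval z)); last exact: mevalC.
rewrite map_mxM map_chart map_base_x map_base_xi map_mx_cst; last first.
  exact: mevalC.
rewrite (@base_xi_ext _ _ (set0th 1 z)) // => l /=.
by rewrite /set0th; case: eqP => _; rewrite ?meval1 ?mevalXU.
Qed.

(** The two flags have proportional xi up to the index i; beyond i, where x vanishes, a diagonal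
    rescaling by s matches the remaining entries. *)
Lemma equiv_sl_chart_mid (l : 'I_d.+1) z (w' : 'S_n) s :
  w' ord0 = i -> w' ord_max = mid l -> l != ord0 -> z l != 0 -> s != 0 ->
  eval_mx q (sl_chart w' (base_x F) ((z l)^-1 *: base_xi (set0th s z))) =
  (s / z l) ^+ m * eval_mx q (base_mx (fun k => z k / s)).
Proof.
move=> w'0 w'1 nl nz_l nz_s.
set xi := (z l)^-1 *: _.
have xi1 : xi 0 (w' ord_max) = 1.
  by rewrite w'1 mxE base_xi_mid /set0th (negbTE nl) mulVf.
have x1 : base_x F (w' ord0) 0 = 1 by rewrite w'0 base_x_i.
have xi_x : xi *m base_x F = 0 by rewrite -scalemxAl base_xi_x scaler0.
pose c := perm_scale F w; pose c' := perm_scale F w'.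
have nz_c : c != 0 := perm_scale_neq0 F w.
have nz_c' : c' != 0 := perm_scale_neq0 F w'.
pose t (k : 'I_n) := if (k <= i)%N then c' / c else c' / c * s.
apply: (qE (t := t)).
- exact: base_mx_cell.
- by rewrite det_sl_chart.
- by move=> k; rewrite /t; case: ifP => _; rewrite !mulf_neq0 ?invr_eq0.
- by rewrite mulf_neq0 ?invr_eq0.
- move=> k; rewrite lin_sl_chart // lin_base_mx -/c -/c' !mxE /t.
  by case: leqP => _; rewrite ?mulr1 ?mulr0 // mulfVK.
- move=> k; rewrite hyp_sl_chart // hyp_base_mx -/c -/c' [in LHS]mxE [in RHS]mxE.
  rewrite [in LHS]mxE /t.
  have -> : base_xi (set0th 1 (fun k => z k / s)) 0 k =
      if (k <= i)%N then s^-1 * base_xi (set0th s z) 0 k else base_xi (set0th s z) 0 k.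
    have zE l' : set0th 1 (fun k => z k / s) l' = s^-1 * set0th s z l'.
      by rewrite /set0th; case: eqP => _; rewrite ?mulVf // mulrC.
    case: leqP => ki; last by rewrite !base_xi_gt.
    have [kj|jk] := ltnP k j; first by rewrite !base_xi_lt // mulr0.
    move: ki; rewrite leq_eqVlt => /orP[/eqP/val_inj ->|ki].
      by rewrite !base_xi_i mulrN mulr_sumr; congr (- _); apply: eq_bigr.
    by have [|l' ->] := @midP k; [rewrite jk ki | rewrite !base_xi_mid zE].
  by case: leqP => _; field; rewrite ?nz_c ?nz_c' ?nz_s ?nz_l.
Qed.

(** Normalising xi at an index [mid l] with z_l nonzero leaves its entry at j free to be
    proportional to s, so the right-hand side is computed without dividing by s. *)
Lemma base_poly_degree z : exists r : {poly F}, forall s, s != 0 ->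
  r.[s] = s ^+ m * base_poly.@[fun l => z l / s].
Proof.
(* If z vanishes off [ord0], the slice point does not depend on s, because [set0th] overwrites the
   entry at [ord0] by 1. *)
have [[l [nl nz_l]]|z0] := pselect (exists l, l != ord0 /\ z l != 0); last first.
  exists (base_poly.@[fun=> 0] *: 'X^m) => s nz_s.
  rewrite hornerZ hornerXn mulrC !base_polyE /base_mx; congr (_ * _).
  rewrite (@base_xi_ext _ _ (set0th 1 (fun l => z l / s))) // => l.
  rewrite /set0th; case: eqVneq => // nl.
  have [->|nz_l] := eqVneq (z l) 0; first by rewrite mul0r.
  by case: z0; exists l.
have [w' [w'0 w'1]] : exists w' : 'S_n, w' ord0 = i /\ w' ord_max = mid l.
  by apply: perm_with_ends; rewrite -val_eqE gtn_eqF // mid_lt.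
exists (z l ^+ m *: mmap_mx (@polyC F) q
    (chart i (mid l) (base_x _)
      ((z l)^-1%:P *: base_xi (set0th 'X (fun k => (z k)%:P))) *m
     map_mx (@polyC F) (perm_sl F w'))) => s nz_s.
rewrite hornerZ -[X in _ * X]/(horner_eval s _).
rewrite (mmap_mxE (ev := horner_eval s)); last by move=> c; apply: hornerC.
rewrite map_mxM map_chart map_mxZ map_base_x map_base_xi map_mx_cst; last first.
  by move=> c; apply: hornerC.
have -> : s ^+ m = z l ^+ m * (s / z l) ^+ m by rewrite -exprMn mulrC divfK.
rewrite base_polyE -mulrA -(equiv_sl_chart_mid w'0 w'1) //.
rewrite /sl_chart w'0 w'1 [X in X *: _](_ : _ = (z l)^-1); last exact: hornerC.
rewrite (@base_xi_ext _ _ (set0th s z)) // => k /=.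
by rewrite /set0th; case: eqP => _; [apply: hornerX | apply: hornerC].
Qed.

(** The diagonal t carries the slice point with parameters y_l / y_0 to the flag of M: it is fixed
    by x up to i and by xi beyond i. The entry of xi at i then agrees by incidence ([sum_ymon]). *)
Lemma eval_mx_generic M : in_cell M ->
  (forall k : 'I_n, (k <= i)%N -> lin M k 0 != 0) ->
  (forall k : 'I_n, (i < k)%N -> hyp M 0 k != 0) ->
  eval_mx q M = ymon M ord0 ^+ m * base_poly.@[fun l => ymon M l / ymon M ord0].
Proof.
move=> cM nz_x nz_xi; have [dM x0 _ xi0 xij] := cM.
set y0 := ymon M ord0.
have nz_y : y0 != 0 by rewrite /y0 /ymon mid0 mulf_neq0 ?nz_x // ltnW.
pose c := perm_scale F w; have nz_c : c != 0 := perm_scale_neq0 F w.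
pose t (k : 'I_n) := if (k <= i)%N then lin M k 0 / c else y0 / (c * hyp M 0 k).
rewrite base_polyE; apply: (qE (t := t)) => //.
- exact: base_mx_cell.
- move=> k; rewrite /t; case: leqP => ki.
    by rewrite mulf_neq0 ?invr_eq0 ?nz_x.
  by apply: mulf_neq0 => //; rewrite invr_eq0 mulf_neq0 // nz_xi.
- move=> k; rewrite lin_base_mx -/c [in RHS]mxE /t; case: leqP => ki.
    by rewrite base_xE // mulr1 divfK.
  by rewrite base_x_gt // !mulr0 x0.
move=> k; rewrite hyp_base_mx -/c [in RHS]mxE /t; case: leqP => ki; last first.
  by rewrite base_xi_gt //; field; rewrite nz_c nz_xi.
have [kj|jk] := ltnP k j; first by rewrite xi0 // base_xi_lt // !(mul0r, mulr0).
have zE l' : set0th 1 (fun l => ymon M l / y0) l' = y0^-1 * ymon M l'.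
  by rewrite /set0th; case: eqP => [->|_]; rewrite ?mulVf // mulrC.
have -> : base_xi (set0th 1 (fun l => ymon M l / y0)) 0 k = y0^-1 * (lin M k 0 * hyp M 0 k).
  move: ki; rewrite leq_eqVlt => /orP[/eqP/val_inj ->|ki].
    rewrite base_xi_i (eq_bigr _ (fun l _ => zE l)) -mulr_sumr sum_ymon //.
    by rewrite mulrN opprK.
  by have [|l' ->] := @midP k; [rewrite jk ki | rewrite base_xi_mid zE].
by field; rewrite ?nz_c ?nz_y.
Qed.

Section Deform.
Variables (S : comNzRingType) (M : 'M[S]_n) (s : S).

Definition deform_u : 'cV[S]_n := \col_k (k < i)%:R.
Definition deform_r : 'rV[S]_n := \row_k (i < k)%:R.

(* A one-parameter family inside the cell along which every x_k with k < i    *)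
(* and every xi_k with k > i becomes nonzero for generic [s].                 *)
Definition deform : 'M[S]_n :=
  (1%:M + (- s *: delta_mx j 0) *m deform_r) *m
  ((1%:M + (s *: deform_u) *m delta_mx 0 i) *m M).

Hypothesis dM : \det M = 1.

Let u_i : delta_mx (0 : 'I_1) i *m (s *: deform_u) = 0.
Proof.
by rewrite -scalemxAr -rowE; apply/matrixP => a b; rewrite !mxE ltnn mulr0.
Qed.

Let r_j : deform_r *m (- s *: delta_mx j (0 : 'I_1)) = 0.
Proof.
rewrite -scalemxAr -colE; apply/matrixP => a b.
by rewrite !mxE ltnNge (ltnW ji) mulr0.
Qed.

Let M1 := (1%:M + (s *: deform_u) *m delta_mx 0 i) *m M.
Let dM1 : \det M1 = 1. Proof. exact: det_transv_mul. Qed.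

Lemma det_deform : \det deform = 1.
Proof. by rewrite det_transv_mul. Qed.

Hypothesis x0 : forall k : 'I_n, (i < k)%N -> lin M k 0 = 0.

Lemma lin_deform k : lin deform k 0 = lin M k 0 + s * (k < i)%:R * lin M i 0.
Proof.
rewrite lin_transv_mul // lin_transv_mul // -rowE.
(* The outer transvection leaves the line alone: [deform_r] lives beyond i, where x vanishes. *)
have -> : (deform_r *m (lin M + row i (lin M) 0 0 *: (s *: deform_u))) 0 0 = 0.
  rewrite mxE big1 // => a _; rewrite !mxE; case: ltnP => ia; rewrite ?mul0r //.
  by move: (x0 ia); rewrite mxE => ->; rewrite ltnNge (ltnW ia) !mulr0 addr0 mulr0.
by rewrite scale0r addr0 !mxE mulrC.
Qed.

Let hyp_M1 (k : 'I_n) : k != i -> hyp M1 0 k = hyp M 0 k.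
Proof.
by move=> ki; rewrite hyp_transv_mulE // [X in _ * X]mxE (negbTE ki) andbF mulr0 subr0.
Qed.

Lemma hyp_deform_lt (k : 'I_n) : (k < i)%N -> hyp deform 0 k = hyp M 0 k.
Proof.
move=> ki; rewrite hyp_transv_mulE // [X in _ * X]mxE ltnNge (ltnW ki) mulr0 subr0.
by rewrite hyp_M1 // -val_eqE ltn_eqF.
Qed.

Lemma hyp_deform_gt (k : 'I_n) : (i < k)%N ->
  hyp deform 0 k = hyp M 0 k + s * hyp M 0 j.
Proof.
move=> ik; rewrite hyp_transv_mulE // [deform_r 0 k]mxE ik mulr1.
rewrite -scalemxAr [X in _ - X]mxE mul_delta_col mulNr opprK.
have ki : k != i by rewrite -val_eqE gtn_eqF.
by rewrite !hyp_M1 // -val_eqE ltn_eqF.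
Qed.

End Deform.

Lemma deform0 (S : comNzRingType) (M : 'M[S]_n) : deform M 0 = M.
Proof. by rewrite /deform oppr0 !scale0r !mul0mx !addr0 !mul1mx. Qed.

Lemma map_deform (S S' : comNzRingType) (ev : {rmorphism S -> S'}) (M : 'M[S]_n) s :
  map_mx ev (deform M s) = deform (map_mx ev M) (ev s).
Proof.
have eu : map_mx ev (deform_u S) = deform_u S'.
  by apply/matrixP => a b; rewrite !mxE rmorph_nat.
have er : map_mx ev (deform_r S) = deform_r S'.
  by apply/matrixP => a b; rewrite !mxE rmorph_nat.
rewrite /deform !map_mxM !map_mxD !map_mx1 !map_mxM !map_mxZ !map_delta_mx.
by rewrite rmorphN eu er.
Qed.

Lemma deform_cell M s : in_cell M -> in_cell (deform M s).
Proof.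
move=> [dM x0 xi xi0 xij]; split.
- exact: det_deform.
- by move=> k ik; rewrite lin_deform // x0 // ltnNge (ltnW ik) mulr0 mul0r addr0.
- by rewrite lin_deform // ltnn mulr0 mul0r addr0.
- by move=> k kj; rewrite hyp_deform_lt ?xi0 // (ltn_trans kj).
- by rewrite hyp_deform_lt.
Qed.

(** Along [deform] both sides are polynomials in s that agree for generic s, hence also at s = 0. *)
Lemma eval_mx_cell : exists2 Q : {mpoly F[d.+1]}, Q \is m.-homog &
  forall M, in_cell M -> eval_mx q M = Q.@[ymon M].
Proof.
have [Q Qm QE] := homogenize_meval base_poly_degree; exists Q => // M cM.
have [dM x0 xi xi0 xij] := cM.
pose Ms := deform (map_mx (@polyC F) M) 'X.
have evMs s : map_mx (horner_eval s) Ms = deform M s.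
  rewrite map_deform map_mx_cst; last by move=> c; apply: hornerC.
  by congr deform; apply: hornerX.
(* Off the roots of [e] the deformed flag is generic; [e] is nonzero because x_i and xi_j do not
   vanish on the cell. *)
pose e : {poly F} := \prod_(k < n)
  (if (k < i)%N then (lin M k 0)%:P + lin M i 0 *: 'X
   else if (i < k)%N then (hyp M 0 k)%:P + hyp M 0 j *: 'X else 1).
have nz_lin (a b : F) : b != 0 -> a%:P + b *: 'X != 0.
  move=> nz_b; apply: contraNneq nz_b => /(congr1 (fun p : {poly F} => p`_1)).
  by rewrite coefD coefC coefZ coefX coef0 add0r mulr1 => ->.
have nz_e : e != 0.
  apply/prodf_neq0 => k _; do ! case: ifP => _; rewrite ?oner_neq0 ?nz_lin //.
have eval_y s : horner_eval s (mmap (@polyC F) (ymon Ms) Q) = Q.@[ymon (deform M s)].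
  rewrite rmorph_mmap; last by move=> c; apply: hornerC.
  apply: meval_eq => l; rewrite /= rmorphM /= -evMs /ymon -map_lin -map_hyp.
  by rewrite [in RHS]mxE [X in _ = _ * X]mxE.
have eval_q s : horner_eval s (mmap_mx (@polyC F) q Ms) = eval_mx q (deform M s).
  by rewrite (mmap_mxE (ev := horner_eval s)) ?evMs // => c; apply: hornerC.
have /(congr1 (horner_eval 0)) : mmap_mx (@polyC F) q Ms = mmap (@polyC F) (ymon Ms) Q.
  apply: (poly_eq_horner nz_e) => s.
  rewrite horner_prod => /prodf_neq0 es.
  apply: etrans (eval_q s) _; apply: etrans _ (esym (eval_y s)).
  have cMs := deform_cell s cM.
  have nz_x (k : 'I_n) : (k <= i)%N -> lin (deform M s) k 0 != 0.
    rewrite lin_deform // leq_eqVlt => /orP[/eqP/val_inj ->|ki].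
      by rewrite ltnn mulr0 mul0r addr0.
    by have := es k isT; rewrite ki hornerD hornerC hornerZ hornerX mulr1 mulrC.
  have nz_xi (k : 'I_n) : (i < k)%N -> hyp (deform M s) 0 k != 0.
    move=> ik; have := es k isT; rewrite ltnNge (ltnW ik) /= ik.
    by rewrite hornerD hornerC hornerZ hornerX mulrC hyp_deform_gt.
  rewrite eval_mx_generic // QE // /ymon mid0 mulf_neq0 ?nz_x ?(ltnW ji) //.
  by rewrite hyp_deform_lt.
by rewrite eval_q eval_y deform0.
Qed.

End Function.

(** By homogeneity, vanishing on the slice gives vanishing wherever z_0 is nonzero; the factor
    ['X_ord0] handles the other points. *)
Lemma dhomog_ymon_eq0 (Q : {mpoly F[d.+1]}) m : Q \is m.-homog ->
  (forall M, in_cell M -> Q.@[ymon M] = 0) -> Q = 0.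
Proof.
move=> Qm Q0.
have /eqP : 'X_ord0 * Q = 0.
  apply: mpoly_eq0_meval => z; rewrite mevalM mevalXU.
  have [->|nz_z] := eqVneq (z ord0) 0; first by rewrite mul0r.
  have -> : Q.@[z] = 0; last by rewrite mulr0.
  rewrite (meval_eq _ (v2 := fun l => z ord0 * (z l / z ord0))); last first.
    by move=> l; rewrite mulrC divfK.
  rewrite (dhomog_meval _ _ Qm).
  rewrite (meval_eq _ (v2 := ymon (base_mx (fun l => z l / z ord0)))).
    by rewrite Q0 ?mulr0 //; apply: base_mx_cell.
  by move=> l; rewrite ymon_base_mx /set0th; case: eqP => [->|//]; rewrite divff.
rewrite mulf_eq0 => /orP[/eqP X0|/eqP//].
have := congr1 (fun p : {mpoly F[d.+1]} => p.@[fun=> 1]) X0.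
by rewrite mevalXU meval0 => /eqP; rewrite oner_eq0.
Qed.

End Core.

(** * Parabolic, Bruhat cells and Schubert varieties *)

Section GenericMatrix.
Variables (F : closedFieldType) (N : nat).
Local Notation n := N.+2.

Definition generic_mx : 'M[{mpoly F[n * n]}]_n := vec_mx (\row_k 'X_k).

Lemma map_generic_mx (M : 'M[F]_n) :
  map_mx (meval (fun k => mxvec M 0 k)) generic_mx = M.
Proof.
rewrite /generic_mx map_vec_mx -[RHS]mxvecK; congr vec_mx.
by apply/rowP => k; rewrite !mxE mevalXU.
Qed.

Lemma eval_mx_mulmx (A B : 'M[F]_n) (q : {mpoly F[n * n]}) :
  exists q', forall M, eval_mx q' M = eval_mx q (A *m M *m B).
Proof.
pose c := @mpolyC (n * n) F.
exists (mmap_mx c q (map_mx c A *m generic_mx *m map_mx c B)) => M.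
rewrite {1}/eval_mx (mmap_mxE (ev := meval (fun k => mxvec M 0 k))); last exact: mevalC.
by rewrite !map_mxM map_generic_mx !map_mx_cst //; apply: mevalC.
Qed.

End GenericMatrix.

(** * Upper triangular matrices *)

Section UpperTriangular.
Variables (F : fieldType) (n : nat).

Definition upper (T : 'M[F]_n) : Prop := forall a b : 'I_n, (b < a)%N -> T a b = 0.

Lemma upper_mul (T T' : 'M[F]_n) : upper T -> upper T' -> upper (T *m T').
Proof.
move=> uT uT' a b ba; rewrite mxE big1 // => c _.
have [ca|ac] := ltnP c a; first by rewrite uT // mul0r.
by rewrite uT' ?mulr0 // (leq_trans ba).
Qed.

Lemma upper_diag_neq0 (T : 'M[F]_n) a : upper T -> \det T = 1 -> T a a != 0.
Proof.
move=> uT; rewrite -det_tr det_trig; last first.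
  by apply/is_trig_mxP => b c bc; rewrite mxE uT.
move=> dT; have : \prod_(b < n) T^T b b != 0 by rewrite dT oner_neq0.
by move/prodf_neq0 => /(_ a isT); rewrite mxE.
Qed.

(** Forward substitution: column b of the equation involves only the entries of v up to b. *)
Lemma upper_row_delta (T : 'M[F]_n) (v : 'rV[F]_n) a : upper T -> \det T = 1 ->
  v *m T = delta_mx 0 a -> (forall b : 'I_n, (b < a)%N -> v 0 b = 0) /\ v 0 a != 0.
Proof.
move=> uT dT e.
have col (b : 'I_n) : (forall c : 'I_n, (c < b)%N -> v 0 c = 0) -> v 0 b * T b b = (b == a)%:R.
  move=> vb; have := congr1 (fun A : 'rV_n => A 0 b) e; rewrite !mxE eqxx /= => <-.
  rewrite (bigD1 b) //= big1 ?addr0 // => c nc.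
  have [cb|] := ltnP c b; first by rewrite vb // mul0r.
  by rewrite leq_eqVlt eq_sym (negbTE (nc : val c != val b)) /= => bc; rewrite uT ?mulr0.
have v0 (b : 'I_n) : (b < a)%N -> v 0 b = 0.
  have [k] := ubnP (val b); elim: k b => // k IH b bk ba.
  have /eqP := col b (fun c cb => IH c (leq_trans cb bk) (ltn_trans cb ba)).
  rewrite -val_eqE (ltn_eqF ba) mulf_eq0 => /orP[/eqP //|].
  by rewrite (negbTE (upper_diag_neq0 b uT dT)).
split=> //; have := col a v0; rewrite eqxx => va.
by apply: contra_eq_neq va => ->; rewrite mul0r eq_sym oner_neq0.
Qed.

End UpperTriangular.

(** * Cosets of P as flags, and Bruhat cells *)

Section Geometry.
Variables (F : numClosedFieldType) (N : nat) (h : 'M[F]_N.+2).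
Hypothesis h_unit : h \in unitmx.
Local Notation n := N.+2.
Local Notation B := (in_basis h).
Implicit Types (g p : 'M[F]_n).

Definition out_basis (M : 'M[F]_n) : 'M[F]_n := h *m M *m invmx h.

Lemma out_basisK : cancel out_basis B.
Proof. by move=> M; rewrite /in_basis /out_basis -!mulmxA mulVmx // mulmx1 mulKmx. Qed.

Lemma in_basisK : cancel B out_basis.
Proof. by move=> M; rewrite /in_basis /out_basis -!mulmxA mulmxV // mulmx1 mulKVmx. Qed.

Lemma in_basisM g g' : B (g *m g') = B g *m B g'.
Proof. by rewrite /in_basis !mulmxA mulmxK. Qed.

Lemma det_in_basis g : \det (B g) = \det g.
Proof. by rewrite !det_mulmx mulrAC -det_mulmx mulVmx // det1 mul1r. Qed.

Lemma SL_in_basis g : SL g -> \det (B g) = 1.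
Proof. by rewrite det_in_basis. Qed.

Lemma SL_out_basis M : \det M = 1 -> SL (out_basis M).
Proof. by move=> dM; rewrite /SL /= -det_in_basis out_basisK. Qed.

Lemma parab_entries p : parab h p <-> [/\ SL p,
  forall k, k != ord0 -> B p k ord0 = 0 &
  forall k, k != ord_max -> B p ord_max k = 0].
Proof.
split=> [[[Sp p1] [_ p2]]|[Sp p1 p2]].
  split=> // k nk; first by apply: p1; rewrite /= lt0n.
  by apply: p2; rewrite /= leqnn andbT ltn_neqAle nk -ltnS ltn_ord.
split; split=> // a b /andP[].
  rewrite ltnS leqn0 => /eqP b0 a0; rewrite (_ : b = ord0); last exact: val_inj.
  by apply: p1; rewrite -lt0n.
move=> bN Na; rewrite (_ : a = ord_max).
  by apply: p2; rewrite -val_eqE ltn_eqF.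
by apply: val_inj; apply/eqP; rewrite eqn_leq Na -ltnS ltn_ord.
Qed.

Lemma parab_lin p : parab h p -> lin (B p) = B p ord0 ord0 *: delta_mx ord0 0.
Proof.
case/parab_entries => _ + _; move: (B p) => M p1.
apply/matrixP => a b; rewrite ord1 !mxE eqxx andbT.
by case: eqP => [->|/eqP/p1 ->]; rewrite ?mulr1 ?mulr0.
Qed.

Lemma parab_row p : parab h p -> delta_mx (0 : 'I_1) ord_max *m B p =
  B p ord_max ord_max *: delta_mx 0 ord_max.
Proof.
case/parab_entries => _ _; move: (B p) => M p2.
apply/matrixP => a b; rewrite ord1 mul_delta_row !mxE eqxx.
by case: eqP => [->|/eqP/p2 ->]; rewrite ?mulr1 ?mulr0.
Qed.

Lemma lin_neq0 (M : 'M[F]_n) : \det M = 1 -> lin M != 0.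
Proof.
move=> dM; apply/eqP => l0; have := congr1 (mulmx (\adj M)) l0.
rewrite /lin colE mulmxA mul_adj_mx dM mul1mx mulmx0 => /matrixP/(_ ord0 0).
by rewrite !mxE !eqxx => /eqP; rewrite oner_eq0.
Qed.

Lemma row_SL_neq0 (M : 'M[F]_n) k : \det M = 1 -> delta_mx (0 : 'I_1) k *m M != 0.
Proof.
move=> dM; apply/eqP => l0; have := congr1 (mulmx^~ (\adj M)) l0.
rewrite /= -mulmxA mul_mx_adj dM mulmx1 mul0mx => /matrixP/(_ 0 k).
by rewrite !mxE !eqxx => /eqP; rewrite oner_eq0.
Qed.

Lemma parab_00 p : parab h p -> B p ord0 ord0 != 0.
Proof.
move=> Pp; have Sp : SL p by case/parab_entries: Pp.
have := lin_neq0 (SL_in_basis Sp); rewrite parab_lin //.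
by apply: contra_neq => ->; rewrite scale0r.
Qed.

Lemma parab_nn p : parab h p -> B p ord_max ord_max != 0.
Proof.
move=> Pp; have Sp : SL p by case/parab_entries: Pp.
have := row_SL_neq0 ord_max (SL_in_basis Sp); rewrite parab_row //.
by apply: contra_neq => ->; rewrite scale0r.
Qed.

Lemma parab_SL p : parab h p -> SL p. Proof. by case/parab_entries. Qed.

Lemma SL_mul g g' : SL g -> SL g' -> SL (g *m g').
Proof. by rewrite /SL /= det_mulmx => -> ->; rewrite mulr1. Qed.

Lemma lin_parab g p : parab h p -> lin (B (g *m p)) = B p ord0 ord0 *: lin (B g).
Proof. by move=> Pp; rewrite in_basisM lin_mul parab_lin // -scalemxAr /lin colE. Qed.

Lemma hyp_parab g p : SL g -> parab h p ->
  hyp (B (g *m p)) = (B p ord_max ord_max)^-1 *: hyp (B g).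
Proof.
move=> Sg Pp; apply: hyp_unique.
  by apply/SL_in_basis/SL_mul => //; apply: parab_SL.
rewrite in_basisM -scalemxAl mulmxA hyp_mulmx; last exact: SL_in_basis.
by rewrite parab_row // scalerA mulVf ?scale1r ?parab_nn.
Qed.

(** The weight of index n - 1 is the cofactor at the last corner. The last row vanishes off that
    corner, so cofactor times corner entry is the determinant 1. *)
Lemma alpha0E p : parab h p -> alpha0 h p = B p ord0 ord0 / B p ord_max ord_max.
Proof.
move=> Pp; have [Sp p1 p2] := (parab_entries p).1 Pp; congr (_ * _).
  rewrite /fund_weight.
  have -> : (\matrix_(i < n, j < n)
        (if (i < 1)%N && (j < 1)%N then B p i j else (i == j)%:R)) =
      diag_mx (\row_(k < n) if k == ord0 then B p ord0 ord0 else 1).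
    apply/matrixP => a b; rewrite !mxE !ltnS !leqn0.
    have [->|na] := eqVneq a ord0; have [->|nb] := eqVneq b ord0.
    - by rewrite !eqxx mulr1n.
    - by rewrite (negbTE (nb : val b != 0%N)) andbF.
    - by rewrite (negbTE (na : val a != 0%N)).
    - by rewrite (negbTE (na : val a != 0%N)).
  rewrite det_diag big_ord_recl big1 ?mulr1 => [|k _]; last by rewrite mxE.
  by rewrite mxE eqxx.
rewrite /fund_weight /=; set A := \matrix_(i, j) _.
have dA : \det A = cofactor A ord_max ord_max.
  rewrite (expand_det_row _ ord_max) (bigD1 ord_max) //= big1 ?addr0.
    by rewrite mxE ltnn eqxx mul1r.
  by move=> k nk; rewrite mxE ltnn eq_sym (negbTE nk) mul0r.
have dp : B p ord_max ord_max * cofactor (B p) ord_max ord_max = 1.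
  rewrite -(SL_in_basis Sp) [RHS](expand_det_row _ ord_max) (bigD1 ord_max) //=.
  by rewrite big1 ?addr0 // => k nk; rewrite p2 // mul0r.
have -> : \det A = cofactor (B p) ord_max ord_max.
  rewrite dA /cofactor; congr (_ * \det _); apply/matrixP => a b; rewrite !mxE.
  by rewrite !lift_max !ltn_ord.
by apply: (mulfI (parab_nn Pp)); rewrite dp mulfV ?parab_nn.
Qed.

(** The matrix of g^-1 g' in the basis h has first column a e_1 and last row b^-1 e_n: this places
    it in P and gives its character. *)
Lemma same_flag g g' a b : SL g -> SL g' -> b != 0 ->
  lin (B g') = a *: lin (B g) -> hyp (B g') = b *: hyp (B g) ->
  exists p, [/\ parab h p, g' = g *m p & alpha0 h p = a * b].
Proof.
move=> Sg Sg' nz_b lE hE.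
have ug : g \in unitmx by rewrite unitmxE (Sg : \det g = 1) unitr1.
have gK : g *m (invmx g *m g') = g' by rewrite mulKVmx.
set p := invmx g *m g' in gK.
have Sp : SL p.
  by rewrite /SL /= det_mulmx det_inv (Sg : \det g = 1) (Sg' : \det g' = 1) invr1 mulr1.
have dBg := SL_in_basis Sg; have dBg' := SL_in_basis Sg'.
have pE : B p = \adj (B g) *m B g'.
  by rewrite -gK in_basisM mulmxA mul_adj_mx dBg mul1mx.
have lp : lin (B p) = a *: delta_mx ord0 0.
  by rewrite pE lin_mul lE -scalemxAr /lin colE mulmxA mul_adj_mx dBg mul1mx.
have hp : delta_mx (0 : 'I_1) ord_max *m B p = b^-1 *: delta_mx 0 ord_max.
  rewrite pE mulmxA -rowE -/(hyp (B g)) -(hyp_mulmx dBg') hE.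
  by rewrite -scalemxAl scalerA mulVf // scale1r.
have Pp : parab h p.
  apply/parab_entries; split=> // k nk.
    by rewrite -linE lp !mxE (negbTE nk) mulr0.
  by rewrite -mul_delta_row hp !mxE (negbTE nk) andbF mulr0.
have p00 : B p ord0 ord0 = a by rewrite -linE lp !mxE !eqxx mulr1.
have pnn : B p ord_max ord_max = b^-1 by rewrite -mul_delta_row hp !mxE !eqxx mulr1.
by exists p; split; rewrite // alpha0E // p00 pnn invrK.
Qed.

Lemma gcoset_refl g : gcoset h g g.
Proof.
exists 1%:M; last by rewrite mulmx1.
have B1 : B 1%:M = 1%:M by rewrite /in_basis mulmx1 mulVmx.
apply/parab_entries; split; first by rewrite /SL /= det1.
  by move=> k nk; rewrite B1 mxE (negbTE nk).
by move=> k nk; rewrite B1 mxE eq_sym (negbTE nk).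
Qed.

Lemma gcoset_flag g g' : SL g -> gcoset h g g' -> [/\ SL g',
  exists2 a, a != 0 & lin (B g') = a *: lin (B g) &
  exists2 b, b != 0 & hyp (B g') = b *: hyp (B g)].
Proof.
move=> Sg [p Pp <-]; split.
- by apply: SL_mul => //; apply: parab_SL.
- by exists (B p ord0 ord0); [apply: parab_00 | apply: lin_parab].
- by exists (B p ord_max ord_max)^-1; [rewrite invr_eq0 parab_nn | apply: hyp_parab].
Qed.

Lemma gcoset_eq g g' a b : SL g -> SL g' -> a != 0 -> b != 0 ->
  lin (B g') = a *: lin (B g) -> hyp (B g') = b *: hyp (B g) -> gcoset h g' = gcoset h g.
Proof.
move=> Sg Sg' nz_a nz_b lE hE; apply/seteqP; split=> x /gcoset_flag.
  case=> // Sx [a' _ la] [b' nz_b' hb].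
  have [||p [Pp -> _]] := same_flag Sg Sx (mulf_neq0 nz_b' nz_b) (a := a' * a).
  - by rewrite la lE scalerA.
  - by rewrite hb hE scalerA.
  - by exists p.
case=> // Sx [a' _ la] [b' nz_b' hb].
have nz : b' / b != 0 by rewrite mulf_neq0 ?invr_eq0.
have [||p [Pp -> _]] := same_flag Sg' Sx nz (a := a' / a).
- by rewrite la lE scalerA divfK.
- by rewrite hb hE scalerA divfK.
- by exists p.
Qed.

Lemma gcoset_mul g p : SL g -> parab h p -> gcoset h (g *m p) = gcoset h g.
Proof.
move=> Sg Pp; have gp : gcoset h g (g *m p) by exists p.
by have [Sgp [a nz_a la] [b nz_b hb]] := gcoset_flag Sg gp; apply: gcoset_eq la hb.
Qed.

Variable w : 'S_n.
Local Notation i := (w ord0).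
Local Notation j := (w ord_max).

Lemma in_cell_scaled (M M' : 'M[F]_n) (t : 'I_n -> F) c : in_cell w M -> \det M' = 1 ->
  (forall k, t k != 0) -> c != 0 -> (forall k, lin M' k 0 = t k * lin M k 0) ->
  (forall k, hyp M' 0 k * t k = c * hyp M 0 k) -> in_cell w M'.
Proof.
move=> [dM x0 xi xi0 xij] dM' nz_t nz_c lE hE; split=> //.
- by move=> k ik; rewrite lE x0 // mulr0.
- by rewrite lE mulf_neq0.
- move=> k kj; have /eqP := hE k; rewrite xi0 // mulr0 mulf_eq0 (negbTE (nz_t k)) orbF.
  by move/eqP.
- have := mulf_neq0 nz_c xij; rewrite -hE mulf_eq0 negb_or => /andP[//].
Qed.

Lemma upper_chart (x : 'cV[F]_n) (xi : 'rV[F]_n) :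
  (forall k : 'I_n, (i < k)%N -> x k 0 = 0) ->
  (forall k : 'I_n, (k < j)%N -> xi 0 k = 0) -> upper (chart i j x xi).
Proof.
move=> x0 xi0; apply: upper_mul => a b ba.
  rewrite !mxE !big_ord1 !mxE eqxx andbT.
  have -> : (a == b) = false by rewrite -val_eqE gtn_eqF.
  case: (eqVneq a j) => [aj|_]; last by rewrite mul0r subr0.
  rewrite aj in ba; rewrite xi0 // -val_eqE ltn_eqF //.
  by rewrite subrr mulr0 subr0.
rewrite !mxE !big_ord1 !mxE !eqxx andbT.
have -> : (a == b) = false by rewrite -val_eqE gtn_eqF.
case: (eqVneq b i) => [bi|_]; last by rewrite mulr0 addr0.
rewrite bi in ba; rewrite x0 //.
have -> : (a == i) = false by rewrite -val_eqE gtn_eqF.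
case: (eqVneq a j) => [aj|_]; last by rewrite mulr0 !subr0 mul0r addr0.
by rewrite -aj x0 // mul0r !subr0 mul0r addr0.
Qed.

(** Conversely to the support computation, the chart of the normalised flag is upper triangular
    ([upper_chart]) and serves as the Borel factor, with [perm_sl] representing w. *)
Lemma bruhat_cellP g : SL g -> bruhat_cell h w (gcoset h g) <-> in_cell w (B g).
Proof.
move=> Sg; split.
  case=> b [u [[Sb ub] [Su uE] eg]].
  have [p Pp gE] : gcoset h (b *m u) g by rewrite -eg; apply: gcoset_refl.
  have := parab_nn Pp; have := parab_00 Pp.
  have := parab_row Pp; have := parab_lin Pp.
  have : B g = B b *m B u *m B p by rewrite -gE !in_basisM.
  have := SL_in_basis Sg; have := SL_in_basis Su; have := SL_in_basis Sb.
  move: (B b) (B u) (B p) (B g) ub uE => T U P M ub uE dT dU dM ME lP rP nz_P0 nz_Pn.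
  have lU : lin U = U i ord0 *: delta_mx i 0.
    apply/matrixP => a c; rewrite ord1 !mxE eqxx andbT.
    have [->|na] := eqVneq a i; first by rewrite mulr1.
    rewrite mulr0; apply/eqP; apply: contraT => /uE e.
    by rewrite e eqxx in na.
  have rU : delta_mx (0 : 'I_1) j *m U = U j ord_max *: delta_mx 0 ord_max.
    apply/matrixP => a c; rewrite ord1 mul_delta_row !mxE eqxx /=.
    have [->|nc] := eqVneq c ord_max; first by rewrite mulr1.
    rewrite mulr0; apply/eqP; apply: contraT => /uE /perm_inj e.
    by rewrite e eqxx in nc.
  have nz_U1 : U i ord0 != 0.
    by have := lin_neq0 dU; rewrite lU; apply: contra_neq => ->; rewrite scale0r.
  have nz_U2 : U j ord_max != 0.
    by have := row_SL_neq0 j dU; rewrite rU; apply: contra_neq => ->; rewrite scale0r.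
  have lM k : lin M k 0 = P ord0 ord0 * (U i ord0 * T k i).
    rewrite ME lin_mul lP -scalemxAr -colE -/(lin _) lin_mul lU -scalemxAr.
    by rewrite mxE [X in _ * X]mxE mul_delta_col.
  have vT : (delta_mx (0 : 'I_1) j *m \adj T) *m T = delta_mx 0 j.
    by rewrite -mulmxA mul_adj_mx dT mulmx1.
  have [v0 vj] := upper_row_delta ub dT vT; set v := _ *m \adj T in vT v0 vj.
  have hM : hyp M = (P ord_max ord_max * U j ord_max)^-1 *: v.
    apply: hyp_unique => //; rewrite -scalemxAl ME !mulmxA vT rU -scalemxAl rP.
    by rewrite !scalerA -mulrA [U j _ * _]mulrC mulVf ?scale1r ?mulf_neq0.
  split=> //.
  - by move=> k ik; rewrite lM ub // !mulr0.
  - by rewrite lM !mulf_neq0 // upper_diag_neq0.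
  - by move=> k kj; rewrite hM mxE v0 ?mulr0.
  - by rewrite hM mxE mulf_neq0 // invr_eq0 mulf_neq0.
move=> [dM x0 xi xi0 xij].
pose x := (lin (B g) i 0)^-1 *: lin (B g).
pose y := (hyp (B g) 0 j)^-1 *: hyp (B g).
have x1 : x i 0 = 1 by rewrite mxE mulVf.
have y1 : y 0 j = 1 by rewrite mxE mulVf.
have yx : y *m x = 0 by rewrite -scalemxAl -scalemxAr hyp_lin // !scaler0.
have ij := perm_ends_neq w.
exists (out_basis (chart i j x y)), (out_basis (perm_sl F w)); split.
- split; first by apply: SL_out_basis; apply: det_chart.
  rewrite out_basisK; apply: upper_chart => k hk; rewrite mxE.
    by rewrite (x0 k hk) mulr0.
  by rewrite (xi0 k hk) mulr0.
- split; first by apply: SL_out_basis; apply: det_perm_sl.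
  move=> a b; rewrite out_basisK perm_slE; case: (eqVneq a (w b)) => // _.
  by rewrite mulr0 eqxx.
have eB : B (out_basis (chart i j x y) *m out_basis (perm_sl F w)) = sl_chart w x y.
  by rewrite in_basisM !out_basisK.
have nz_c := perm_scale_neq0 F w.
apply: (@gcoset_eq (out_basis (chart i j x y) *m out_basis (perm_sl F w)) g
  (lin (B g) i 0 / perm_scale F w)  (hyp (B g) 0 j * perm_scale F w)) => //.
- by apply: SL_mul; apply: SL_out_basis; rewrite ?det_chart ?det_perm_sl.
- by rewrite mulf_neq0 ?invr_eq0.
- by rewrite mulf_neq0.
- by rewrite eB lin_sl_chart // !scalerA divfK // mulfV ?scale1r.
- by rewrite eB hyp_sl_chart // !scalerA mulfK // mulfV ?scale1r.
Qed.


End Geometry.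

(** * Torus action on flags *)

Section Torus.
Variables (F : numClosedFieldType) (N : nat).
Local Notation n := N.+2.
Variables (t : 'I_n -> F) (M : 'M[F]_n).
Hypotheses (nz_t : forall k, t k != 0) (dt : \prod_k t k = 1) (dM : \det M = 1).

Definition torus_mx : 'M[F]_n := diag_mx (\row_k t k).

Lemma det_torus_mx : \det torus_mx = 1.
Proof. by rewrite det_diag -[RHS]dt; apply: eq_bigr => k _; rewrite mxE. Qed.

Lemma det_torus_mul : \det (torus_mx *m M) = 1.
Proof. by rewrite det_mulmx det_torus_mx dM mulr1. Qed.

Lemma lin_torus k : lin (torus_mx *m M) k 0 = t k * lin M k 0.
Proof. by rewrite lin_mul mul_diag_mx [LHS]mxE [X in X * _]mxE. Qed.

Lemma hyp_torus k : hyp (torus_mx *m M) 0 k * t k = hyp M 0 k.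
Proof.
have -> : hyp M = hyp (torus_mx *m M) *m torus_mx.
  apply: hyp_unique => //; rewrite -mulmxA hyp_mulmx //; exact: det_torus_mul.
by rewrite mul_mx_diag [RHS]mxE [X in _ = _ * X]mxE.
Qed.

End Torus.

(** * Invariant sections on the Schubert variety *)

Section InvariantSections.
Variables (F : numClosedFieldType) (N : nat) (h : 'M[F]_N.+2).
Hypothesis h_unit : h \in unitmx.
Variable w : 'S_N.+2.
Local Notation n := N.+2.
Local Notation B := (in_basis h).
Local Notation i := (w ord0).
Local Notation j := (w ord_max).
Local Notation preim := (schubert_preim h w).

Lemma cell_schubert g : SL g -> in_cell w (B g) -> schubert h w (gcoset h g).
Proof.
by move=> Sg /(bruhat_cellP h_unit w Sg) cg; split; [exists g | move=> Z _; apply].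
Qed.

Lemma cell_preim M : in_cell w M -> exists g : preim, sval g = out_basis h M.
Proof.
move=> cM; have SM : SL (out_basis h M) by apply: SL_out_basis => //; case: cM.
have schM : schubert h w (gcoset h (out_basis h M)).
  by apply: cell_schubert; rewrite ?out_basisK.
pose P g := SL g /\ schubert h w (gcoset h g).
by exists (exist P _ (conj SM schM)).
Qed.

(** The cosets on which q vanishes identically form a closed set containing the cell. *)
Lemma schubert_eq0 (q : {mpoly F[n * n]}) :
  (forall g, SL g -> in_cell w (B g) -> eval_mx q g = 0) ->
  forall g, SL g -> schubert h w (gcoset h g) -> eval_mx q g = 0.
Proof.
move=> q0 g Sg [_ sch].
suff /sch : flag_closed h [set X | forall g', SL g' -> X = gcoset h g' -> eval_mx q g' = 0].
  apply=> // X [b [u [Pb Pu ->]]] g' Sg' e; apply: q0 => //.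
  by apply/bruhat_cellP => //; exists b, u; split.
(* Vanishing on a whole coset is expressed at one representative by all the right translates of q
   under P. *)
exists [set q' | exists2 p, parab h p & forall g', eval_mx q' g' = eval_mx q (g' *m p)].
apply/seteqP; split=> g1 [S1 Z1]; split=> //.
  move=> q' [p Pp ->]; have Sp := parab_SL Pp.
  by apply: Z1; [apply: SL_mul | rewrite gcoset_mul].
move=> g' Sg' e; have [p Pp gE] : gcoset h g1 g' by rewrite e; apply: gcoset_refl.
have [q' q'E] := eval_mx_mulmx 1%:M p q.
have /Z1 : [set q' | exists2 p, parab h p &
    forall g', eval_mx q' g' = eval_mx q (g' *m p)] q'.
  by exists p => // M; rewrite q'E mul1mx.
by rewrite q'E mul1mx gE.
Qed.


(** An n-th root r rescales t to determinant 1. What remains, r^-1 on x and c r on xi, comes from an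
    element of P with [alpha0] equal to c. *)
Lemma inv_section_equivariant m f (q : {mpoly F[n * n]}) :
  inv_sections m f -> (forall g : preim, f g = eval_mx q (sval g)) ->
  cell_equivariant w m (fun M => eval_mx q (out_basis h M)).
Proof.
move=> [[_ fP] fT] fq M M' t c cM dM' nz_t nz_c lE hE.
pose r := n.-root (\prod_k t k)^-1.
have rX : r ^+ n = (\prod_k t k)^-1 by rewrite rootCK.
have nz_p : \prod_k t k != 0 by apply/prodf_neq0.
have nz_r : r != 0.
  by have := expf_eq0 r n; rewrite rX invr_eq0 (negbTE nz_p) => /esym/negbT.
pose t' k := r * t k.
have nz_t' k : t' k != 0 by rewrite mulf_neq0.
have dt' : \prod_k t' k = 1.
  by rewrite big_split /= prodr_const card_ord rX mulVf.
have dM : \det M = 1 by case: cM.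
pose M1 := torus_mx t' *m M.
have dM1 : \det M1 = 1 by apply: det_torus_mul.
have cM1 : in_cell w M1.
  apply: (in_cell_scaled (c := 1) cM dM1 nz_t') => //; first by rewrite oner_neq0.
    by move=> k; apply: lin_torus.
  by move=> k; rewrite mul1r; apply: hyp_torus.
have cM' := in_cell_scaled cM dM' nz_t nz_c lE hE.
have [g gE] := cell_preim cM; have [g1 g1E] := cell_preim cM1.
have [g' g'E] := cell_preim cM'.
have tg : f g1 = f g.
  apply: (fT g g1 (out_basis h (torus_mx t'))).
    split; first by apply: SL_out_basis => //; apply: det_torus_mx.
    by rewrite out_basisK // diag_mx_is_diag.
  rewrite gE g1E /M1 -{1}(out_basisK h_unit (torus_mx t')) -{1}(out_basisK h_unit M).
  by rewrite -in_basisM // in_basisK.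
have nz_cr : c * r != 0 by rewrite mulf_neq0.
have Sg1 : SL (sval g1) by case: (svalP g1).
have Sg' : SL (sval g') by case: (svalP g').
have [||p [Pp pE aE]] := same_flag h_unit Sg1 Sg' nz_cr (a := r^-1).
- rewrite g1E g'E !out_basisK //; apply/matrixP => k l; rewrite ord1 lE [RHS]mxE.
  by rewrite lin_torus // /t' mulrA mulKf.
- rewrite g1E g'E !out_basisK //; apply/matrixP => l k; rewrite ord1 [RHS]mxE.
  apply: (mulIf (nz_t k)); rewrite hE -(hyp_torus dt' dM k) /t'.
  by rewrite -!mulrA; congr (_ * _); rewrite mulrCA.
rewrite -gE -g'E -!fq -tg (fP _ _ _ Pp pE) aE; congr (_ ^+ _ * _).
by rewrite mulrC mulfK.
Qed.

Hypothesis ji : (j < i)%N.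
Local Notation d := (cell_dim w).

Definition flag_eval (Q : {mpoly F[d.+1]}) : preim -> F :=
  fun g => Q.@[ymon (w := w) (B (sval g))].

Lemma flag_evalB : {morph flag_eval : Q Q' / Q - Q'}.
Proof. by move=> Q Q'; apply/funext => g; rewrite /flag_eval mevalB. Qed.

Lemma flag_evalM : monoid_morphism flag_eval.
Proof.
split; first by apply/funext => g; rewrite /flag_eval meval1.
by move=> Q Q'; apply/funext => g; rewrite /flag_eval mevalM.
Qed.

HB.instance Definition _ :=
  GRing.isZmodMorphism.Build {mpoly F[d.+1]} (preim -> F) flag_eval flag_evalB.
HB.instance Definition _ :=
  GRing.isMonoidMorphism.Build {mpoly F[d.+1]} (preim -> F) flag_eval flag_evalM.

Lemma ymon_eval_mx (Q : {mpoly F[d.+1]}) : exists q : {mpoly F[n * n]},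
  forall g, eval_mx q g = Q.@[ymon (w := w) (B g)].
Proof.
pose c := @mpolyC (n * n) F.
pose G := map_mx c (invmx h) *m generic_mx F N *m map_mx c h.
exists (mmap c (ymon (w := w) G) Q) => g.
pose ev := meval (fun k => mxvec g 0 k).
have GE : map_mx ev G = B g.
  by rewrite !map_mxM map_generic_mx !map_mx_cst //; apply: mevalC.
rewrite /eval_mx (rmorph_mmap (ev := ev)); last exact: mevalC.
apply: meval_eq => l; rewrite -GE /= /ymon rmorphM -map_lin -map_hyp.
by rewrite [in RHS]mxE [X in _ = _ * X]mxE.
Qed.

Lemma flag_eval_inv m Q : Q \is m.-homog -> inv_sections m (flag_eval Q).
Proof.
move=> Qm; split; [split|].
- by have [q qE] := ymon_eval_mx Q; exists q.
- move=> g g' p Pp e; rewrite /flag_eval e -(dhomog_meval _ _ Qm); apply: meval_eq => l.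
  have Sg : SL (sval g) by case: (svalP g).
  rewrite /ymon lin_parab // hyp_parab // alpha0E // [X in X * _ = _]mxE [X in _ * X = _]mxE.
  by rewrite mulrACA.
- move=> g g' t [St Dt] e; rewrite /flag_eval; apply: meval_eq => l.
  have dg : \det (B (sval g)) = 1 by apply: SL_in_basis => //; case: (svalP g).
  pose s k := B t k k.
  have tE : B t = torus_mx s.
    apply/matrixP => a b; rewrite /torus_mx /s; move: (B t) Dt => T /is_diag_mxP DT.
    rewrite !mxE; case: eqVneq => [->|nab]; first by rewrite mulr1n.
    by rewrite DT.
  rewrite e in_basisM // tE /ymon.
  have ds : \prod_k s k = 1.
    rewrite -[RHS](SL_in_basis h_unit St) tE det_diag.
    by apply: eq_bigr => k _; rewrite mxE.
  by rewrite lin_torus -(hyp_torus ds dg); ring.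
Qed.

Lemma flag_eval_bij m :
  set_bij [set Q : {mpoly F[d.+1]} | Q \is m.-homog] (@inv_sections _ _ h w m) flag_eval.
Proof.
split.
- by move=> Q; apply: flag_eval_inv.
- move=> Q Q'; rewrite !inE /= => Qm Qm' e; apply/eqP; rewrite -subr_eq0; apply/eqP.
  apply: (dhomog_ymon_eq0 ji (m := m)); first exact: rpredB.
  move=> M /cell_preim [g gE]; have := congr1 (fun f => f g) e.
  by rewrite /flag_eval gE out_basisK // mevalB => ->; rewrite subrr.
- move=> f inv_f; have [[[q fq] _] _] := inv_f.
  (* [q'] is [q] written in the basis h, in which the cell is described. *)
  have [q' q'E] := eval_mx_mulmx h (invmx h) q.
  have fE : cell_equivariant w m (eval_mx q').
    move=> M M' t c cM dM' nz_t nz_c lE hE; rewrite !q'E.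
    exact: (inv_section_equivariant inv_f fq cM dM' nz_t nz_c lE hE).
  have [Q Qm QE] := eval_mx_cell ji fE; exists Q => //.
  apply/funext => g; have [Sg sg] := svalP g.
  have [r rE] := ymon_eval_mx Q.
  apply/eqP; rewrite fq /flag_eval -rE -subr_eq0 -mevalB; apply/eqP.
  (* The formula is known on the cell only; the difference of the two sides is a polynomial
     function, so its vanishing passes to the closure. *)
  apply: (schubert_eq0 _ Sg sg) => g' Sg' cg'.
  rewrite /eval_mx mevalB -!/(eval_mx _ _) rE -QE // q'E.
  by rewrite -/(out_basis h _) in_basisK // subrr.
Qed.

Lemma inv_Proj_iso : Proj_iso (invAlg h w) (polyAlg F d).
Proof.
apply: (@graded_iso_Proj_iso F (invAlg h w) (polyAlg F d) flag_eval).
  by move=> c; apply/funext => g; apply: mevalC.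
exact: flag_eval_bij.
Qed.

End InvariantSections.

(** Equality of the two indices contradicts injectivity of w; if i < j, an invariant of positive
    degree vanishes on the cell, hence on X_P(w). *)
Lemma semistable_lt (F : numClosedFieldType) N (h : 'M[F]_N.+2) (w : 'S_N.+2) :
  h \in unitmx -> semistable h w !=set0 -> (w ord_max < w ord0)%N.
Proof.
move=> h_unit [x [_ [m [f [g [m0 inv_f _ nz_f]]]]]].
have [[[q fq] _] _] := inv_f; have [Sg sg] := svalP g.
rewrite ltnNge leq_eqVlt; apply/negP => /orP[/eqP/val_inj/perm_inj//|ij].
case/negP: nz_f; rewrite fq; apply/eqP; apply: (schubert_eq0 h_unit _ Sg sg) => g' Sg' cg'.
rewrite -[g'](in_basisK h_unit).
exact: (cell_equivariant_lt (inv_section_equivariant h_unit inv_f fq) m0 ij cg').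
Qed.

Theorem corollary5p2 (R : realType) (n : nat) (hn : (1 < n)%N)
    (h : 'M[R[i]]_n) (hh : h \in unitmx) (w : 'S_n) (hw : min_coset_rep w)
    (hss : semistable h w !=set0) :
  exists d : nat, Proj_iso (invAlg h w) (polyAlg R[i] d).
Proof.
case: n hn h hh w hw hss => [|[|N]] // _ h hh w _ hss.
by exists (cell_dim w); apply: (inv_Proj_iso hh (semistable_lt hh hss)).
Qed.
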